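(* Let $n,N,m\ge 1$ be integers, let $q_1,\dots,q_N:\mathbb{R}^{2n}\to\mathbb{C}$ be complex-valued quadratic forms with $\mathrm{Re}\,q_j\ge 0$ on $\mathbb{R}^{2n}$ for $1\le j\le N$, let $F_j$ be the Hamilton map of $q_j$, and let $\Omega_0$ be an open subset of $\mathbb{R}^{2n}$. Assume that there exists $c_0>0$ such that for all $X\in\Omega_0$, $$\sum_{k=0}^m\ \sum_{\substack{j=1,\dots,N,\\ (l_1,\dots,l_k)\in\{1,\dots,N\}^k}}\mathrm{Re}\,q_j(\mathrm{Im}\,F_{l_1}\cdots\mathrm{Im}\,F_{l_k}X)\ \ge\ c_0|X|^2$$ (the $k=0$ term being $\sum_{j=1}^N\mathrm{Re}\,q_j(X)$). Then there exist $N$ real-valued weight functions $$g_j\in S_{\Omega_0}\big(1,\langle X\rangle^{-\frac{2}{2m+1}}dX^2\big),\quad 1\le j\le N,$$ and constants $c,c_1,\dots,c_N>0$ such that for all $X\in\Omega_0$, $$1+\sum_{j=1}^N\big(\mathrm{Re}\,q_j(X)+c_jH_{\mathrm{Im}q_j}g_j(X)\big)\ \ge\ c\,\langle X\rangle^{\frac{2}{2m+1}}.$$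
   Context: $\langle X\rangle=(1+|X|^2)^{1/2}$ for $X=(x,\xi)\in\mathbb{R}^{2n}$. Symplectic form: $\sigma((x,\xi),(y,\eta))=\xi\cdot y-x\cdot\eta$. The Hamilton map $F\in M_{2n}(\mathbb{C})$ of a complex-valued quadratic form $q$ on $\mathbb{R}^{2n}$ is the unique matrix with $q(X;Y)=\sigma(X,FY)$ for all $X,Y\in\mathbb{R}^{2n}$, where $q(\cdot;\cdot)$ is the polarized form of $q$; $\mathrm{Re}\,F=\frac12(F+\overline F)$ and $\mathrm{Im}\,F=\frac1{2i}(F-\overline F)$. Hamilton vector field: for a real-valued smooth function $f$ on $\mathbb{R}^{2n}$, $H_f=\frac{\partial f}{\partial\xi}\cdot\frac{\partial}{\partial x}-\frac{\partial f}{\partial x}\cdot\frac{\partial}{\partial\xi}$. Symbol classes: for $\Omega\subset\mathbb{R}^{2n}$ open, $M\in C^\infty(\Omega,(0,\infty))$ and $r,s\in\mathbb{R}$, $S_\Omega(M(X)^r,M(X)^{-2s}dX^2)$ is the set of $a\in C^\infty(\Omega)$ such that for every $\alpha\in\mathbb{N}^{2n}$ there is $C_\alpha>0$ with $|\partial_X^\alpha a(X)|\le C_\alpha M(X)^{r-s|\alpha|}$ for all $X\in\Omega$. Thus $g\in S_{\Omega_0}(1,\langle X\rangle^{-2/(2m+1)}dX^2)$ means $|\partial^\alpha g(X)|\le C_\alpha\langle X\rangle^{-|\alpha|/(2m+1)}$ on $\Omega_0$. *)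

(* Defs.v *)
From mathcomp Require Import all_boot all_order all_algebra.
From mathcomp Require Import all_classical all_reals all_analysis.
From mathcomp Require Import complex.

Set Implicit Arguments.
Unset Strict Implicit.
Unset Printing Implicit Defensive.

Import Order.TTheory GRing.Theory Num.Theory.
Import numFieldNormedType.Exports.

Local Open Scope classical_set_scope.
Local Open Scope ring_scope.

Section EuclideanSpace.
Context {R : realType} {d : nat}.
Implicit Types (f : 'cV[R]_d -> R) (W : set 'cV[R]_d) (X : 'cV[R]_d).

(* The library norm on matrices is the sup norm; it gives the usual topology
   of R^d, but the statement is about the Euclidean norm. *)
Definition sqnorm X : R := \sum_(i < d) X i 0 ^+ 2.

Definition japanese X : R := Num.sqrt (1 + sqnorm X).

Definition partial (i : 'I_d) f : 'cV[R]_d -> R :=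
  fun X => 'D_(delta_mx i 0) f X.

Definition partials (s : seq 'I_d) f : 'cV[R]_d -> R := foldr partial f s.

(* f is C^oo on the open set W; f is a total function, but only its
   restriction to W matters. *)
Definition smooth_on W f : Prop :=
  forall (s : seq 'I_d) X, W X ->
    {for X, continuous (partials s f)} /\
    forall i : 'I_d, derivable (partials s f) X (delta_mx i 0).

Definition mlength (alpha : {ffun 'I_d -> nat}) : nat :=
  (\sum_(i < d) alpha i)%N.

(* d^alpha = d_0^(alpha 0) ... d_(d-1)^(alpha (d-1)); the order of
   differentiation is immaterial for smooth functions. *)
Definition mpartial (alpha : {ffun 'I_d -> nat}) f : 'cV[R]_d -> R :=
  partials (flatten [seq nseq (alpha i) i | i <- enum 'I_d]) f.

(* The real-valued elements of S_W(M^r, M^(-2s) dX^2), for a smooth positive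
   weight M. *)
Definition symbol_class W (M : 'cV[R]_d -> R) (r s : R) f : Prop :=
  smooth_on W f /\
  forall alpha : {ffun 'I_d -> nat}, exists2 C : R, 0 < C &
    forall X, W X ->
      `|mpartial alpha f X| <= C * M X `^ (r - s * (mlength alpha)%:R).

End EuclideanSpace.

Section PhaseSpace.
Context {R : realType} {n : nat}.
Implicit Types (q : 'cV[R]_(n + n) -> R[i]) (F : 'M[R[i]]_(n + n)).
Implicit Types (X Y : 'cV[R]_(n + n)).

Definition complexify X : 'cV[R[i]]_(n + n) := map_mx (real_complex R) X.

(* A point of R^2n is X = col_mx x xi.  The symplectic form is extended
   C-bilinearly to C^2n. *)
Definition sigma (X Y : 'cV[R[i]]_(n + n)) : R[i] :=
  \sum_(i < n) (dsubmx X i 0 * usubmx Y i 0 - usubmx X i 0 * dsubmx Y i 0).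

Definition quadratic_form q : Prop :=
  exists A : 'M[R[i]]_(n + n),
    forall X, q X = ((complexify X)^T *m A *m complexify X) 0 0.

Definition polarized q X Y : R[i] := (q (X + Y) - q X - q Y) / 2%:R.

Definition is_hamilton_map q F : Prop :=
  forall X Y, polarized q X Y = sigma (complexify X) (F *m complexify Y).

Definition re_form q : 'cV[R]_(n + n) -> R := fun X => complex.Re (q X).
Definition im_form q : 'cV[R]_(n + n) -> R := fun X => complex.Im (q X).

(* (F - conj F) / 2i is the entrywise imaginary part. *)
Definition im_mx F : 'M[R]_(n + n) := map_mx (@complex.Im R) F.

(* H_f g: coordinates lshift n i are the x_i, rshift n i the xi_i. *)
Definition hamilton_field (f g : 'cV[R]_(n + n) -> R) : 'cV[R]_(n + n) -> R :=
  fun X => \sum_(i < n)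
    (partial (rshift n i) f X * partial (lshift n i) g X
     - partial (lshift n i) f X * partial (rshift n i) g X).

End PhaseSpace.

(* Main.v *)
Require Import Defs.
From mathcomp Require Import all_boot all_order all_algebra.
From mathcomp Require Import all_classical all_reals all_analysis.
From mathcomp Require Import complex.
From mathcomp Require Import ring lra.

Set Implicit Arguments.
Unset Strict Implicit.
Unset Printing Implicit Defensive.

Import Order.TTheory GRing.Theory Num.Theory.
Import numFieldNormedType.Exports.

Local Open Scope classical_set_scope.
Local Open Scope ring_scope.

(** The proof exhibits the weights in closed form, without any cutoff function.

Write s = 1/(2m+1), U = 1 + |X|^2, T = U^s = <X>^(2s), and B_l = Im F_l.  The
Hamilton vector field of Im q_l is twice the linear vector field X |-> B_l X
([hamilton_field_along]).  Let r_0 be the sum of the forms Re q_j and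
r_(k+1)(X) = sum_l r_k(B_l X), so that r_k collects the words of length k in
the hypothesis ([bil_gram_words]); r_k(.,.) also denotes the polar form.

Rescale with the time step 1/T: put a_k = T^(-2k) r_k, let
Q = T + a_0 + ... + a_m be an energy, and set
  g_l = (sum_(k < m) c_k T^(-(2k+1)) r_k(X, B_l X)) / Q
for nonnegative constants c_k.  Two facts make this work.

- Differentiating r_k(X, B_l X) along B_l X produces r_k(B_l X, B_l X), whose
  sum over l is r_(k+1)(X), plus r_k(X, B_l B_l X), which Cauchy-Schwarz bounds
  by the neighbouring levels k and k+2.  For constants c_k chosen
  from the top level downwards, as in hypocoercivity arguments, these errors
  and those due to differentiating Q are absorbed
  ([hypocoercive_coefficients], [pointwise_gain]).  The outcome is
    sum_l B_l g_l >= T (a_0 + ... + a_m) / Q - C r_0 - C.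
  The hypothesis gives a_0 + ... + a_m >= c_0 (T - 1) on Omega_0, hence the first
  term is at least c (T - 1) ([harmonic_gain]), while C r_0 is absorbed by
  sum_j Re q_j once the g_l are multiplied by a small constant
  ([subelliptic_multipliers]).

- Since Q >= T everywhere, Q and the numerators are symbols of weight Q for the
  metric <X>^(-2s) dX^2 on the whole space ([symb_energy], [symb_cross]), and
  Q is elliptic in that class, so the quotients g_l are symbols of weight 1.
  The symbol calculus needed for this is built on a recursive description of
  the symbol estimates ([symb_upto]), where products, inverses and solutions of
  first-order equations ([symb_ode]) are handled by induction on the number of
  derivatives. *)

(** * Hypocoercive coefficients and the estimate at one point *)

(** Constants c_k for which the gains c_k a_(k+1) dominate the Cauchy-Schwarz
errors of the neighbouring levels, up to the two extreme levels a_0 and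
a_(m+1).  The induction on m prepends a level and doubles the inequality for
the remaining ones: u a_1 exceeds their loss 2 C a_1 by 2 a_1, and the parameter K u
makes the new error in a_1 and a_2 exactly a_1 + a_2. *)
Lemma hypocoercive_coefficients {R : realFieldType} (K : R) (m : nat) :
  0 < K -> exists (c lam : nat -> R) (C : R),
    [/\ forall k, 0 <= c k, forall k, 0 < lam k, 0 <= C &
     forall a : nat -> R, (forall k, 0 <= a k) ->
       \sum_(k < m) a k.+1 - C * a 0%N - C * a m.+1 <=
       \sum_(k < m) c k * (a k.+1 -
          K * (lam k * a k + (lam k)^-1 * (a k.+1 + a k.+2)))].
Proof.
move=> K0; elim: m => [|m [c [lam [C [c0 lam0 C0 IH]]]]].
  exists (fun=> 0), (fun=> 1), 0; split=> // a _.
  by rewrite !big_ord0 !mul0r !subr0.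
set u := 2 * C + 2.
have u0 : 0 < u by rewrite /u; lra.
have Ku : 0 < K * u by rewrite mulr_gt0.
exists (fun k => if k is k'.+1 then 2 * c k' else u).
exists (fun k => if k is k'.+1 then lam k' else K * u).
exists (u * K * (K * u) + 2 * C + 1); split.
- by case=> [|k]; [exact: ltW|rewrite mulr_ge0].
- by case.
- by rewrite addr_ge0 // addr_ge0 ?mulr_ge0 // ltW.
move=> a a0; rewrite !big_ord_recl /=.
have := IH (fun k => a k.+1) (fun k => a0 k.+1); rewrite /= => {}IH.
set S1 := \sum_(k < m) _ in IH; set S2 := \sum_(k < m) _ in IH.
set S3 := \sum_(k < m) _; set S4 := \sum_(k < m) _.
have -> : S3 = S1 by [].
have -> : S4 = 2 * S2 by rewrite mulr_sumr; apply: eq_bigr => k _; rewrite mulrA.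
have a2 : a 2%N <= S1 + a m.+2.
  have -> : S1 + a m.+2 = \sum_(k < m.+1) a k.+2 by rewrite big_ord_recr.
  by rewrite big_ord_recl /= lerDl sumr_ge0.
rewrite /bump /=.
have -> : u * (a 1%N - K * (K * u * a 0%N + (K * u)^-1 * (a 1%N + a 2%N)))
        = u * a 1%N - u * K * (K * u) * a 0%N - (a 1%N + a 2%N).
  by field; rewrite !lt0r_neq0.
have h0 := a0 0%N; have h1 := a0 1%N; have hm := a0 m.+2.
have hC := mulr_ge0 C0 h0.
have hK : 0 <= u * K * (K * u) * a m.+2.
  by rewrite mulr_ge0 // mulr_ge0 ?mulr_ge0 // ltW.
move: IH a2 hC hK h0 h1 hm; rewrite /u; set w := (_ * K * _); move=> IH a2 hC hK h0 h1 hm.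
lra.
Qed.

(** The estimate at one point.  Here a_k is the k-th level, Y k l the k-th cross
term along the l-th field, T Z k l + (2k+1) th_l Y k l its derivative, T the
inverse of the time step, - th_l the logarithmic derivative of T, and
P_l / Q the l-th weight; the right-hand side of the conclusion is the
derivative of the weights.  The constant K of the coefficient inequality
depends on N, m and the bounds Cth and Ca, but not on the coefficients c. *)
Lemma pointwise_gain {R : realFieldType} (N m : nat) (T Cth Ca C : R)
    (a c lam : nat -> R) (th : 'I_N -> R) (Y Z : nat -> 'I_N -> R) :
  let C2 := Cth + 2 * (2 + Ca) + (2 * m)%:R * Cth in
  let K := N%:R * (1 + C2 + (2 * m + 1)%:R * Cth) in
  let S := \sum_(k < m.+1) a k in
  let Q := T + S in
  let P l := \sum_(k < m) c k * Y k l in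
  let DP l := \sum_(k < m) c k * (T * Z k l + (2 * k + 1)%:R * th l * Y k l) in
  let DQ l := - th l * T
              + \sum_(k < m.+1) (2 * T * Y k l + (2 * k)%:R * th l * a k) in
  1 <= T -> (forall k, 0 <= a k) -> a m.+1 <= Ca -> 0 <= C ->
  (forall k, 0 <= c k) -> (forall k, 0 < lam k) ->
  (forall l, `|th l| <= Cth) ->
  (forall k l mu, 0 < mu -> `|Y k l| <= mu * a k + mu^-1 * a k.+1) ->
  (forall k mu, 0 < mu ->
     a k.+1 - N%:R * (mu * a k + mu^-1 * a k.+2) <= \sum_l Z k l) ->
  \sum_(k < m) a k.+1 - C * a 0%N - C * a m.+1 <=
    \sum_(k < m) c k * (a k.+1 -
       K * (lam k * a k + (lam k)^-1 * (a k.+1 + a k.+2))) ->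
  T * S / Q - (C + 1) * a 0%N - C * Ca <=
    \sum_l (DP l / Q - P l * DQ l / Q ^+ 2).
Proof.
move=> C2 K S Q P DP DQ T1 a0 aCa C0 c0 lam0 thC HY HZ Hc.
have T0 : 0 < T by lra.
have S0 : 0 <= S by exact: sumr_ge0.
have TQ : T <= Q by rewrite /Q lerDl.
have Q0 : 0 < Q by exact: lt_le_trans TQ.
have Ca0 : 0 <= Ca by exact: le_trans aCa.
have SQ : S <= Q by rewrite /Q lerDr ltW.
pose e k := lam k * a k + (lam k)^-1 * (a k.+1 + a k.+2).
have e0 k : 0 <= e k.
  by rewrite addr_ge0 // mulr_ge0 ?addr_ge0 // ?invr_ge0 ltW.
have Ye k l : `|Y k l| <= e k.
  apply: le_trans (HY k l _ (lam0 k)) _; rewrite lerD2l ler_wpM2l ?invr_ge0 ?lerDl //.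
  exact: ltW.
have Ze k : a k.+1 - N%:R * e k <= \sum_l Z k l.
  apply: le_trans (HZ k _ (lam0 k)); rewrite lerD2l lerN2 ler_wpM2l //.
  by rewrite lerD2l ler_wpM2l ?lerDr // invr_ge0 ltW.
have DQb l : `|DQ l| <= C2 * (T * Q).
  have QTQ : Q <= T * Q by rewrite ler_peMl // ltW.
  have TTQ : T <= T * Q by rewrite ler_peMr ?(le_trans T1 TQ) // ltW.
  have Cth0 : 0 <= Cth by apply: le_trans (thC l).
  apply: le_trans (ler_normD _ _) _; rewrite /C2.
  rewrite [leRHS](_ : _ = Cth * (T * Q) +
    (2 * (2 + Ca) * (T * Q) + (2 * m)%:R * Cth * (T * Q))); last by ring.
  apply: lerD.
    rewrite normrM normrN (gtr0_norm T0); apply: ler_pM => //; exact: ltW.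
  apply: le_trans (ler_norm_sum _ _ _) _.
  have H (k : 'I_m.+1) : `|2 * T * Y k l + (2 * k)%:R * th l * a k| <=
      2 * T * (a k + a k.+1) + (2 * m)%:R * Cth * a k.
    apply: le_trans (ler_normD _ _) _; apply: lerD.
      rewrite normrM ger0_norm; last by rewrite mulr_ge0 // ltW.
      rewrite ler_wpM2l //; first by rewrite mulr_ge0 // ltW.
      by have := HY k l 1 ltr01; rewrite invr1 !mul1r.
    rewrite !normrM (ger0_norm (a0 _)) normr_nat ler_wpM2r //.
    by rewrite ler_pM // ler_nat leq_mul // -ltnS ltn_ord.
  apply: le_trans (ler_sum _ (fun k _ => H k)) _.
  rewrite big_split /= -!mulr_sumr; apply: lerD; last first.
    rewrite ler_wpM2l ?mulr_ge0 //; exact: le_trans QTQ.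
  rewrite big_split /= -/S.
  have S'Q : \sum_(i < m.+1) a i.+1 <= Q + Ca.
    rewrite big_ord_recr /= lerD //.
    by apply: le_trans SQ; rewrite /S big_ord_recl /= lerDr.
  have -> : 2 * (2 + Ca) * (T * Q) = 2 * T * (Q + (Q + Ca * Q)) by ring.
  rewrite ler_wpM2l ?lerD //; first by rewrite mulr_ge0 // ltW.
  apply: le_trans S'Q _; rewrite lerD2l ler_peMr //; lra.
have C20 (l : 'I_N) : 0 <= C2.
  have := le_trans (normr_ge0 _) (DQb l).
  by rewrite pmulr_lge0 // mulr_gt0.
(* The errors from differentiating Q and the powers of T are of the same form
   as the Cauchy-Schwarz errors, and are all absorbed in K. *)
have step : (T / Q) * (\sum_(k < m) c k * (a k.+1 - K * e k)) <=
    \sum_l (DP l / Q - P l * DQ l / Q ^+ 2).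
  have Pl l : `|P l| <= \sum_(k < m) c k * e k.
    apply: le_trans (ler_norm_sum _ _ _) _; apply: ler_sum => k _.
    by rewrite normrM ger0_norm // ler_wpM2l.
  have DPl l : T * (\sum_(k < m) c k * (Z k l - (2 * m + 1)%:R * Cth * e k)) <= DP l.
    rewrite mulr_sumr; apply: ler_sum => k _.
    rewrite mulrCA ler_wpM2l // mulrBr lerD2l lerNl.
    have Cth0 : 0 <= Cth by apply: le_trans (thC l).
    apply: le_trans (ler_norm _) _; rewrite normrN !normrM normr_nat.
    apply: (@le_trans _ _ (1 * ((2 * m + 1)%:R * Cth * e k))).
      rewrite mul1r ler_pM ?mulr_ge0 // ler_pM // ler_nat leq_add2r leq_mul //.
      exact: ltnW.
    by rewrite ler_wpM2r // !mulr_ge0.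
  have PDQ l : P l * DQ l / Q ^+ 2 <= T / Q * (\sum_(k < m) c k * (C2 * e k)).
    apply: le_trans (ler_norm _) _; rewrite !normrM normfV normrX (gtr0_norm Q0).
    rewrite ler_pdivrMr ?exprn_gt0 //.
    have -> : T / Q * (\sum_(k < m) c k * (C2 * e k)) * Q ^+ 2 =
              (\sum_(k < m) c k * e k) * (C2 * (T * Q)).
      under eq_bigr do rewrite mulrCA.
      by rewrite -mulr_sumr; field; rewrite lt0r_neq0.
    by rewrite ler_pM.
  apply: (@le_trans _ _ (\sum_l (T / Q * (\sum_(k < m) c k *
      (Z k l - ((2 * m + 1)%:R * Cth + C2) * e k))))); last first.
    apply: ler_sum => l _.
    have -> : \sum_(k < m) c k * (Z k l - ((2 * m + 1)%:R * Cth + C2) * e k) =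
       \sum_(k < m) c k * (Z k l - (2 * m + 1)%:R * Cth * e k) -
       \sum_(k < m) c k * (C2 * e k).
      by rewrite -sumrB; apply: eq_bigr => k _; ring.
    rewrite mulrBr lerD ?lerN2 ?PDQ // mulrAC ler_wpM2r ?invr_ge0 ?DPl //.
    exact: ltW.
  rewrite -mulr_sumr ler_wpM2l //; first by rewrite divr_ge0 // ltW.
  rewrite exchange_big /=.
  apply: ler_sum => k _; rewrite -mulr_sumr ler_wpM2l // sumrB sumr_const card_ord.
  have -> : a k.+1 - K * e k = (a k.+1 - N%:R * e k) -
     ((2 * m + 1)%:R * Cth + C2) * e k *+ N.
    by rewrite -[_ *+ N]mulr_natl /K; ring.
  by rewrite lerD2r.
apply: le_trans step.
apply: (@le_trans _ _ (T / Q * (\sum_(k < m) a k.+1 - C * a 0%N - C * a m.+1))); last first.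
  by rewrite ler_wpM2l ?divr_ge0 // ltW.
have -> : \sum_(k < m) a k.+1 = S - a 0%N.
  by rewrite /S big_ord_recl /= addrAC subrr add0r.
have TQ1 : T / Q <= 1 by rewrite ler_pdivrMr // mul1r.
have TQ0 : 0 <= T / Q by rewrite divr_ge0 // ltW.
have -> : T / Q * (S - a 0%N - C * a 0%N - C * a m.+1) =
  T * S / Q - (T / Q) * ((C + 1) * a 0%N) - (T / Q) * (C * a m.+1) by ring.
rewrite !lerD ?lerN2 //.
  by rewrite ler_piMl // mulr_ge0 // addr_ge0.
apply: (@le_trans _ _ (C * a m.+1)); last by rewrite ler_wpM2l.
by rewrite ler_piMl // mulr_ge0.
Qed.

(** * Symbol calculus for a general gain per derivative *)

Section SymbolCalculus.
Context {R : realType} {d : nat} (lam : 'cV[R]_d -> R).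
Hypothesis lam_ge0 : forall X, 0 <= lam X.
Implicit Types (f g W V : 'cV[R]_d -> R) (X : 'cV[R]_d).

(** [symb_upto n W f]: f has continuous partial derivatives up to order n on the
whole space, those of order k being bounded by a constant times W lam^k.  The
recursion peels off the derivative that is applied first. *)
Fixpoint symb_upto (n : nat) W f : Prop :=
  [/\ continuous f,
      exists2 C : R, 0 <= C & forall X, `|f X| <= C * W X
    & if n is n'.+1 then forall i : 'I_d,
        (forall X, derivable f X (delta_mx i 0)) /\
        symb_upto n' (fun X => W X * lam X) (partial i f)
      else True].

(** Symbols of weight W: the estimates hold at every order.  Neither W nor lam
is required to be smooth. *)
Definition symb W f : Prop := forall n, symb_upto n W f.

Lemma symb_upto_continuous n W f : symb_upto n W f -> continuous f.
Proof. by case: n => [|n] []. Qed.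

Lemma symb_upto_bound n W f : symb_upto n W f ->
  exists2 C : R, 0 <= C & forall X, `|f X| <= C * W X.
Proof. by case: n => [|n] []. Qed.

Lemma symb_uptoW n W f : symb_upto n.+1 W f -> symb_upto n W f.
Proof.
elim: n W f => [|n IH] W f [fc fb fd]; split=> // i.
by have [df sf] := fd i; split=> //; apply: IH.
Qed.

Lemma symb_upto_le n W V f (C : R) : 0 <= C -> (forall X, W X <= C * V X) ->
  symb_upto n W f -> symb_upto n V f.
Proof.
move=> C0; elim: n W V f => [|n IH] W V f WV [fc [D D0 fb] fd];
    (split=> //; first (exists (D * C); first exact: mulr_ge0)).
- by move=> X; rewrite -mulrA (le_trans (fb X)) // ler_wpM2l.
- by move=> X; rewrite -mulrA (le_trans (fb X)) // ler_wpM2l.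
- move=> i; have [df sf] := fd i; split=> //; apply: IH sf => X.
  by rewrite mulrA ler_wpM2r.
Qed.

Lemma symb_le W V f (C : R) : 0 <= C -> (forall X, W X <= C * V X) ->
  symb W f -> symb V f.
Proof. by move=> C0 WV sf n; apply: symb_upto_le C0 WV (sf n). Qed.

Lemma partial_cst i (c : R) : partial i (fun _ : 'cV[R]_d => c) = fun=> 0.
Proof. by apply/funext => X; exact: derive_cst. Qed.

Lemma partialD i f g :
  (forall X, derivable f X (delta_mx i 0)) ->
  (forall X, derivable g X (delta_mx i 0)) ->
  partial i (fun X => f X + g X) = fun X => partial i f X + partial i g X.
Proof. by move=> df dg; apply/funext => X; rewrite /partial -deriveD. Qed.

Lemma partialM i f g :
  (forall X, derivable f X (delta_mx i 0)) ->
  (forall X, derivable g X (delta_mx i 0)) ->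
  partial i (fun X => f X * g X) =
  fun X => f X * partial i g X + g X * partial i f X.
Proof.
by move=> df dg; apply/funext => X; rewrite /partial [LHS]deriveM.
Qed.

Lemma partialV i f : (forall X, f X != 0) ->
  (forall X, derivable f X (delta_mx i 0)) ->
  partial i (fun X => (f X)^-1) =
  fun X => - (partial i f X * ((f X)^-1 * (f X)^-1)).
Proof.
move=> f0 df; apply/funext => X; rewrite /partial deriveV //.
by rewrite scaleNr -invfM -expr2 mulrC.
Qed.

Lemma symb_upto0 n W : (forall X, 0 <= W X) -> symb_upto n W (fun=> 0).
Proof.
have b W' : (forall X, 0 <= W' X) -> exists2 C : R, 0 <= C &
    forall X : 'cV[R]_d, `|0 : R| <= C * W' X.
  by move=> W0; exists 0 => // X; rewrite normr0 mul0r.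
elim: n W => [|n IH] W W0; split => //; try exact: cst_continuous; try exact: b.
move=> i; split; first by move=> X; exact: derivable_cst.
by rewrite partial_cst; apply: IH => X; rewrite mulr_ge0.
Qed.

Lemma symb_cst W (c : R) : (exists2 C, 0 <= C & forall X, 1 <= C * W X) ->
  symb W (fun=> c).
Proof.
move=> [C C0 CW].
have W0 X : 0 <= W X.
  have := lt_le_trans ltr01 (CW X); rewrite pmulr_rgt0 => [/ltW //|].
  rewrite lt0r C0 andbT; apply/eqP => C00.
  by have := CW X; rewrite C00 mul0r ler10.
suff H n : symb_upto n W (fun=> c) by [].
have b : exists2 C : R, 0 <= C & forall X : 'cV[R]_d, `|c| <= C * W X.
  exists (`|c| * C); first by rewrite mulr_ge0.
  by move=> X; rewrite -mulrA ler_peMr.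
case: n => [|n]; split => //; try exact: cst_continuous.
move=> i; split; first by move=> X; exact: derivable_cst.
by rewrite partial_cst; apply: symb_upto0 => X; rewrite mulr_ge0.
Qed.

Lemma symb_uptoD n W f g :
  symb_upto n W f -> symb_upto n W g -> symb_upto n W (fun X => f X + g X).
Proof.
elim: n W f g => [|n IH] W f g [fc [C C0 fb] fd] [gc [D D0 gb] gd].
  split=> //; first by move=> X; apply: continuousD; [exact: fc|exact: gc].
  exists (C + D); first exact: addr_ge0.
  by move=> X; rewrite mulrDl (le_trans (ler_normD _ _)) // lerD.
split=> //; first by move=> X; apply: continuousD; [exact: fc|exact: gc].
  exists (C + D); first exact: addr_ge0.
  by move=> X; rewrite mulrDl (le_trans (ler_normD _ _)) // lerD.
move=> i; have [df sf] := fd i; have [dg sg] := gd i.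
split; first by move=> X; exact: derivableD.
by rewrite partialD //; apply: IH.
Qed.

Lemma symbD W f g : symb W f -> symb W g -> symb W (fun X => f X + g X).
Proof. by move=> sf sg n; apply: symb_uptoD. Qed.

Lemma symb_sum (k : nat) W (F : 'I_k -> 'cV[R]_d -> R) :
  (forall X, 0 <= W X) ->
  (forall j, symb W (F j)) -> symb W (fun X => \sum_(j < k) F j X).
Proof.
move=> W0; elim: k F => [|k IH] F sF.
  under eq_fun do rewrite big_ord0.
  by move=> n; apply: symb_upto0.
by under eq_fun do rewrite big_ord_recl; apply: symbD => //; apply: IH.
Qed.

Lemma symb_uptoM n W V f g : symb_upto n W f -> symb_upto n V g ->
  symb_upto n (fun X => W X * V X) (fun X => f X * g X).
Proof.
have b W' V' f' g' : (exists2 C : R, 0 <= C & forall X, `|f' X| <= C * W' X) ->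
    (exists2 C : R, 0 <= C & forall X, `|g' X| <= C * V' X) ->
    exists2 C : R, 0 <= C & forall X : 'cV[R]_d, `|f' X * g' X| <= C * (W' X * V' X).
  move=> [C C0 fb] [D D0 gb]; exists (C * D); first exact: mulr_ge0.
  by move=> X; rewrite mulrACA normrM ler_pM.
elim: n W V f g => [|n IH] W V f g sf sg.
  have [fc fb _] := sf; have [gc gb _] := sg.
  by split=> //; [move=> X; apply: continuousM; [exact: fc|exact: gc]|exact: b].
have [fc fb fd] := sf; have [gc gb gd] := sg.
split=> //; [by move=> X; apply: continuousM; [exact: fc|exact: gc]|exact: b|].
move=> i; have [df sdf] := fd i; have [dg sdg] := gd i.
split; first by move=> X; exact: derivableM.
rewrite partialM //; apply: symb_uptoD.
  apply: symb_upto_le ler01 _ (IH _ _ _ _ (symb_uptoW sf) sdg) => X.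
  by rewrite mul1r mulrA.
apply: symb_upto_le ler01 _ (IH _ _ _ _ (symb_uptoW sg) sdf) => X.
by rewrite mul1r mulrA [V X * _]mulrC.
Qed.

Lemma symbM W V f g : symb W f -> symb V g ->
  symb (fun X => W X * V X) (fun X => f X * g X).
Proof. by move=> sf sg n; apply: symb_uptoM. Qed.

Lemma symbZ W c f : symb W f -> symb W (fun X => c * f X).
Proof.
move=> sf; have s1 : symb (fun=> 1) (fun=> c).
  by apply: symb_cst; exists 1 => // X; rewrite mulr1.
by apply: symb_le ler01 _ (symbM s1 sf) => X.
Qed.

Lemma symbV W f (c : R) : 0 < c -> (forall X, 0 < W X) ->
  (forall X, c * W X <= f X) -> symb W f ->
  symb (fun X => (W X)^-1) (fun X => (f X)^-1).
Proof.
move=> c0 W0 Wf sf.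
have f0 X : 0 < f X by apply: lt_le_trans (Wf X); rewrite mulr_gt0.
have fN0 X : f X != 0 by rewrite gt_eqF.
have b : exists2 C : R, 0 <= C & forall X : 'cV[R]_d, `|(f X)^-1| <= C * (W X)^-1.
  exists c^-1; first by rewrite invr_ge0 ltW.
  move=> X; rewrite gtr0_norm ?invr_gt0 // -invfM lef_pV2 ?posrE ?mulr_gt0 //.
have fc := symb_upto_continuous (sf 0%N).
have fVc : continuous (fun X => (f X)^-1).
  by move=> X; apply: continuousV; [exact: fN0|exact: fc].
elim=> [|n IH]; first by split.
split=> // i; have [_ _ /(_ i) [df sdf]] := sf n.+1.
split; first by move=> X; apply: derivableV.
rewrite partialV //.
have -> : (fun X => - (partial i f X * ((f X)^-1 * (f X)^-1))) =
          (fun X => -1 * (partial i f X * ((f X)^-1 * (f X)^-1))).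
  by apply/funext => X; rewrite mulN1r.
have s1 : symb_upto n (fun=> 1) (fun=> (-1 : R)).
  by apply: symb_cst; exists 1 => // X; rewrite mulr1.
apply: symb_upto_le ler01 _ (symb_uptoM s1 (symb_uptoM sdf (symb_uptoM IH IH))) => X.
rewrite [leLHS](_ : _ = 1 * ((W X)^-1 * lam X)) //.
by field; rewrite gt_eqF.
Qed.

(** If the first derivatives of f are d_i f = c th_i f + e_i, where th_i is a symbol of
weight lam and e_i a symbol of weight W lam, then continuity of f and a bound on
f itself are enough to make f a symbol of weight W. *)
Lemma symb_ode W f (th e : 'I_d -> 'cV[R]_d -> R) (c : R) :
  continuous f -> (exists2 C : R, 0 <= C & forall X, `|f X| <= C * W X) ->
  (forall i X, is_derive X (delta_mx i 0) f (c * th i X * f X + e i X)) ->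
  (forall i, symb lam (th i)) ->
  (forall i, symb (fun X => W X * lam X) (e i)) -> symb W f.
Proof.
move=> fc fb fd sth se; elim=> [|n IH]; first by split.
split=> // i; split; first by move=> X; have [] := fd i X.
have -> : partial i f = (fun X => c * (th i X * f X) + e i X).
  apply/funext => X; by have [_] := fd i X; rewrite /partial -mulrA.
apply: symb_uptoD; last exact: se.
have s1 : symb_upto n (fun=> 1) (fun=> c).
  by apply: symb_cst; exists 1 => // X; rewrite mulr1.
apply: symb_upto_le ler01 _ (symb_uptoM s1 (symb_uptoM (sth i n) IH)) => X.
by rewrite !mul1r mulrC.
Qed.

Lemma symb_partials W f (s : seq 'I_d) : symb W f ->
  symb (fun X => W X * lam X ^+ size s) (partials s f) /\
  forall i X, derivable (partials s f) X (delta_mx i 0).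
Proof.
move=> sf.
have H : forall s, symb (fun X => W X * lam X ^+ size s) (partials s f).
  elim=> [|i s' IH] /=.
    by apply: symb_le ler01 _ sf => X; rewrite mul1r expr0 mulr1.
  move=> n; have [_ _ /(_ i) [_ si]] := IH n.+1.
  by apply: symb_upto_le ler01 _ si => X; rewrite mul1r exprSr mulrA.
split=> [|i X]; first exact: H.
by have [_ _ /(_ i) [di _]] := H s 1%N.
Qed.

End SymbolCalculus.

(** * Real bilinear forms and their derivatives *)

Section BilinearForms.
Context {R : realType} {d : nat}.
Implicit Types (M B : 'M[R]_d) (X Y V : 'cV[R]_d).

(** The real bilinear form X^T M Y. *)
Definition bil M X Y : R := (X^T *m M *m Y) 0 0.

Lemma bilE M X Y : bil M X Y = \sum_i \sum_j X i 0 * M i j * Y j 0.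
Proof.
rewrite /bil mxE exchange_big /=; apply: eq_bigr => j _.
by rewrite mxE mulr_suml; apply: eq_bigr => i _; rewrite mxE.
Qed.

Lemma bilDl M X X' Y : bil M (X + X') Y = bil M X Y + bil M X' Y.
Proof. by rewrite /bil linearD /= !mulmxDl mxE. Qed.

Lemma bilDr M X Y Y' : bil M X (Y + Y') = bil M X Y + bil M X Y'.
Proof. by rewrite /bil mulmxDr mxE. Qed.

Lemma bilZl M (c : R) X Y : bil M (c *: X) Y = c * bil M X Y.
Proof. by rewrite /bil linearZ /= -!scalemxAl mxE. Qed.

Lemma bilZr M (c : R) X Y : bil M X (c *: Y) = c * bil M X Y.
Proof. by rewrite /bil -scalemxAr mxE. Qed.

Lemma bil_mxD M M' X Y : bil (M + M') X Y = bil M X Y + bil M' X Y.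
Proof. by rewrite /bil mulmxDr mulmxDl mxE. Qed.

Lemma bil_mx_sum (k : nat) (M : 'I_k -> 'M[R]_d) X Y :
  bil (\sum_j M j) X Y = \sum_j bil (M j) X Y.
Proof. by rewrite /bil mulmx_sumr mulmx_suml summxE. Qed.

Lemma bil_trmx M X Y : bil M^T X Y = bil M Y X.
Proof.
rewrite [RHS](_ : _ = (Y^T *m M *m X)^T 0 0); last by rewrite mxE.
by rewrite /bil !trmx_mul trmxK mulmxA.
Qed.

Lemma bil_mulmxr M B X Y : bil (M *m B) X Y = bil M X (B *m Y).
Proof. by rewrite /bil !mulmxA. Qed.

Lemma bil_mulmxl M B X Y : bil (B^T *m M) X Y = bil M (B *m X) Y.
Proof. by rewrite /bil trmx_mul !mulmxA. Qed.

Lemma bil1 X : bil 1%:M X X = sqnorm X.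
Proof.
by rewrite /bil mulmx1 mxE; apply: eq_bigr => i _; rewrite mxE expr2.
Qed.

Lemma bil1_delta i X : bil 1%:M (delta_mx i 0) X = X i 0.
Proof. by rewrite /bil mulmx1 trmx_delta -rowE mxE. Qed.

Lemma sum_bil_delta M X Y :
  \sum_i X i 0 * bil M (delta_mx i 0) Y = bil M X Y.
Proof.
rewrite bilE; apply: eq_bigr => i _.
rewrite bilE (bigD1 i) //= [X in _ + X]big1 ?addr0 => [|k ki].
  by rewrite mulr_sumr; apply: eq_bigr => j _; rewrite mxE !eqxx mul1r mulrA.
by apply: big1 => j _; rewrite mxE (negbTE ki) !mul0r.
Qed.

Lemma sqnorm_ge0 X : 0 <= sqnorm X.
Proof. by apply: sumr_ge0 => i _; exact: sqr_ge0. Qed.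

Lemma sqr_coord_le X i : X i 0 ^+ 2 <= sqnorm X.
Proof.
by rewrite /sqnorm (bigD1 i) //= lerDl; apply: sumr_ge0 => j _; exact: sqr_ge0.
Qed.

Lemma bil_bound M : exists2 C : R, 0 <= C &
  forall X, `|bil M X X| <= C * sqnorm X.
Proof.
exists (\sum_i \sum_j `|M i j|).
  by apply: sumr_ge0 => i _; apply: sumr_ge0.
move=> X; rewrite bilE (le_trans (ler_norm_sum _ _ _)) // mulr_suml.
apply: ler_sum => i _; rewrite (le_trans (ler_norm_sum _ _ _)) // mulr_suml.
apply: ler_sum => j _; rewrite mulrAC normrM mulrC ler_wpM2l //.
have hi := sqr_coord_le X i; have hj := sqr_coord_le X j.
rewrite ler_norml; apply/andP; split; nra.
Qed.

(** Cauchy-Schwarz for a nonnegative form, in additive form. *)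
Lemma bil_young M X Y (mu : R) : M^T = M -> (forall V, 0 <= bil M V V) ->
  0 < mu -> `|bil M X Y| <= mu * bil M X X + mu^-1 * bil M Y Y.
Proof.
move=> sM pM mu0.
have muV : mu * mu^-1 = 1 by rewrite divff // gt_eqF.
have muV0 : 0 < mu^-1 by rewrite invr_gt0.
have sym : bil M Y X = bil M X Y by rewrite -[in LHS]sM bil_trmx.
have key (e : R) : e ^+ 2 = 1 ->
    e * bil M X Y <= mu * bil M X X + mu^-1 * bil M Y Y.
  move=> e2; have := pM (mu *: X - e *: Y).
  rewrite -scaleNr bilDl !bilDr !bilZl !bilZr sym => h.
  have hX := pM X; have hY := pM Y.
  have : 0 <= mu^-1 * (mu * (mu * bil M X X) + mu * (- e * bil M X Y) +
     (- e * (mu * bil M X Y) + - e * (- e * bil M Y Y))).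
    by rewrite mulr_ge0 // ltW.
  have -> : mu^-1 * (mu * (mu * bil M X X) + mu * (- e * bil M X Y) +
     (- e * (mu * bil M X Y) + - e * (- e * bil M Y Y))) =
     (mu * mu^-1) * (mu * bil M X X - 2 * (e * bil M X Y)) +
      e ^+ 2 * (mu^-1 * bil M Y Y) by ring.
  rewrite muV e2.
  have := mulr_ge0 (ltW mu0) hX; have := mulr_ge0 (ltW muV0) hY.
  lra.
have k1 := key 1 (expr1n _ _).
have k2 : - 1 * bil M X Y <= mu * bil M X X + mu^-1 * bil M Y Y.
  by apply: key; rewrite sqrrN expr1n.
by rewrite ler_norml; apply/andP; split; lra.
Qed.

(** An exact quadratic expansion along a line gives the derivative. *)
Lemma is_derive_expansion (f : 'cV[R]_d -> R) X V (a b : R) :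
  (forall h : R, f (h *: V + X) = f X + h * a + h ^+ 2 * b) ->
  is_derive X V f a.
Proof.
move=> fE.
have H : (fun h : R => h^-1 *: ((f \o shift X) (h *: V) - f X)) @ 0^' --> a.
  have -> : a = a + 0 * b by rewrite mul0r addr0.
  apply: (@cvg_trans _ ((fun h : R => a + h * b) @ 0^')); last first.
    apply: cvgD; first exact: cvg_cst.
    by apply: cvgM; [exact: cvg_within|exact: cvg_cst].
  apply: near_eq_cvg; near=> h.
  have h0 : h != 0 by near: h; exact: nbhs_dnbhs_neq.
  by rewrite /= fE /GRing.scale /=; field.
by split; [apply/cvg_ex; exists a|exact: cvg_lim H].
Unshelve. all: by end_near. Qed.

Lemma is_derive_bilr M V X v : is_derive X v (bil M V) (bil M V v).
Proof.
apply: (@is_derive_expansion _ _ _ _ 0) => h.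
by rewrite bilDr bilZr mulr0 addr0 addrC.
Qed.

Lemma is_derive_quad M X v :
  is_derive X v (fun X => bil M X X) (bil (M + M^T) v X).
Proof.
apply: (@is_derive_expansion _ _ _ _ (bil M v v)) => h.
by rewrite bilDr !bilDl !bilZr !bilZl bil_mxD bil_trmx; ring.
Qed.

Lemma continuous_quad M : continuous (fun X => bil M X X).
Proof.
have -> : (fun X => bil M X X) =
    \sum_i \sum_j ((fun X : 'cV[R]_d => X i 0 : R) * cst (M i j) *
                   (fun X : 'cV[R]_d => X j 0 : R)).
  apply/funext => X; rewrite bilE fct_sumE; apply: eq_bigr => i _.
  by rewrite fct_sumE.
move=> X; apply: differentiable_continuous.
apply: differentiable_sum => i; apply: differentiable_sum => j.
apply: differentiableM; last exact: differentiable_coord.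
by apply: differentiableM; first exact: differentiable_coord.
Qed.

Lemma continuous_bilr M V : continuous (bil M V).
Proof.
have -> : bil M V = \sum_i \sum_j (cst (V i 0 * M i j) *
                   (fun X : 'cV[R]_d => X j 0 : R)).
  apply/funext => X; rewrite bilE fct_sumE; apply: eq_bigr => i _.
  by rewrite fct_sumE.
move=> X; apply: differentiable_continuous.
apply: differentiable_sum => i; apply: differentiable_sum => j.
by apply: differentiableM; last exact: differentiable_coord.
Qed.

Lemma is_derive_powR_comp (f : 'cV[R]_d -> R) X V (df p : R) : 0 < f X ->
  is_derive X V f df ->
  is_derive X V (fun Y => f Y `^ p) (p * f X `^ (p - 1) * df).
Proof.
move=> fX [dfX <-].
pose g := fun h : R => f (h *: V + X).
have dE (F : 'cV[R]_d -> R) : 'D_V F X = 'D_1 (fun h : R => F (h *: V + X)) 0.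
  rewrite /derive; set g1 := fun h => h^-1 *: _; set g2 := fun h => h^-1 *: _.
  suff -> : g1 = g2 by [].
  rewrite funeqE /g1 /g2 => h /=.
  by rewrite addr0 scale0r add0r [_%:A]mulr1.
have g0 : g 0 = f X by rewrite /g scale0r add0r.
have dg : derivable g 0 1 by exact: (derivable1P _ _ _).1 dfX.
have [dpow powE] : is_derive (g 0) (1 : R) (fun a : R => a `^ p) (p * g 0 `^ (p - 1)).
  by apply: is_derive1_powR; rewrite g0.
split.
  apply: (derivable1P _ _ _).2; apply/derivable1_diffP.
  apply: (@differentiable_comp _ _ _ _ g (fun a : R => a `^ p)); exact/derivable1_diffP.
rewrite dE -derive1E (derive1_comp dg dpow) !derive1E powE g0.
by rewrite -dE.
Qed.

End BilinearForms.

(** * Powers of the Japanese bracket as symbols *)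

Section Weights.
Context {R : realType} {d : nat} (s : R).
Hypothesis s_le1 : s <= 1.
Implicit Types (M B : 'M[R]_d) (X Y V : 'cV[R]_d) (W : 'cV[R]_d -> R).

(** <X>^2. *)
Definition bracket2 X : R := 1 + sqnorm X.
Local Notation U := bracket2.
(** The gain <X>^(-s) of one derivative. *)
Definition decay X : R := U X `^ (- (s / 2)).
Local Notation lam := decay.
(** Half the logarithmic derivative of <X>^2 in the i-th coordinate; every power
of <X>^2 is a solution of a first-order equation with this coefficient. *)
Definition logder (i : 'I_d) X : R := X i 0 / U X.

Lemma bracket2_ge1 X : 1 <= U X.
Proof. by rewrite lerDl sqnorm_ge0. Qed.

Lemma bracket2_gt0 X : 0 < U X.
Proof. exact: lt_le_trans (bracket2_ge1 X). Qed.

Lemma bracket2_ge0 X : 0 <= U X.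
Proof. exact: ltW (bracket2_gt0 X). Qed.

Lemma bracket2_powD X (p r : R) : U X `^ (p + r) = U X `^ p * U X `^ r.
Proof. by rewrite powRD // (gt_eqF (bracket2_gt0 X)) implybT. Qed.

Lemma bracket2_pow_gt0 X (p : R) : 0 < U X `^ p.
Proof. exact: powR_gt0 (bracket2_gt0 X). Qed.

Lemma decay_gt0 X : 0 < lam X.
Proof. exact: bracket2_pow_gt0. Qed.

Lemma decay_ge0 X : 0 <= lam X.
Proof. exact: ltW (decay_gt0 X). Qed.

Lemma bracket2_pow_le X (p r : R) : p <= r -> U X `^ p <= U X `^ r.
Proof. by apply: ler_powR; exact: bracket2_ge1. Qed.

Lemma is_derive_bracket2 X i : is_derive X (delta_mx i 0) U (2 * X i 0).
Proof.
have -> : U = cst 1 + (fun X => bil 1%:M X X).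
  by apply/funext => Y; rewrite /bracket2 -bil1.
apply: is_derive_eq (is_deriveD (is_derive_cst _ _ _) (is_derive_quad _ _ _)) _.
by rewrite add0r trmx1 bil_mxD bil1_delta; ring.
Qed.

Lemma is_derive_bracket2_pow (p : R) X i :
  is_derive X (delta_mx i 0) (fun X => U X `^ p)
    (2 * p * logder i X * U X `^ p).
Proof.
apply: is_derive_eq.
  exact: is_derive_powR_comp (bracket2_gt0 X) (is_derive_bracket2 X i).
rewrite bracket2_powD (_ : -1 = - 1%:R) // powR_invn ?bracket2_ge0 //.
by rewrite expr1 /logder; ring.
Qed.

Lemma continuous_bracket2_pow (p : R) : continuous (fun X => U X `^ p).
Proof.
have Uc : continuous U.
  have -> : U = cst 1 + (fun X => bil 1%:M X X).
    by apply/funext => Y; rewrite /bracket2 -bil1.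
  move=> X; apply: (@continuousD R R^o _ (cst (1 : R)) (fun X => bil 1%:M X X)).
    exact: cst_continuous.
  exact: continuous_quad.
have -> : (fun X => U X `^ p) = (fun X => expR (p * ln (U X))).
  by apply/funext => X; rewrite /powR gt_eqF ?bracket2_gt0.
move=> X.
apply: (@continuous_comp _ _ _ (fun X => p * ln (U X)) (@expR R)); last first.
  exact: continuous_expR.
apply: (@continuousM R _ (cst p) (fun X => ln (U X))).
  exact: cst_continuous.
apply: (@continuous_comp _ _ _ U (@ln R)); first exact: Uc.
exact: continuous_ln (bracket2_gt0 X).
Qed.

(** This case without a power of <X>, and the next ones, precede [symb_logder],
which the general case [symb_pow_linear] depends on. *)
Lemma symb_linear0 W M V :
  (exists2 C : R, 0 <= C & forall X, `|bil M V X| <= C * W X) ->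
  (exists2 C : R, 0 <= C & forall X, 1 <= C * (W X * lam X)) ->
  symb lam W (bil M V).
Proof.
move=> Wb W1; apply: (@symb_ode R d lam decay_ge0 W (bil M V)
    (fun _ _ => 0) (fun i _ => bil M V (delta_mx i 0)) 0).
- exact: continuous_bilr.
- exact: Wb.
- move=> i X; apply: is_derive_eq; first exact: is_derive_bilr.
  by rewrite !mul0r add0r.
- by move=> i n; apply: symb_upto0; exact: decay_ge0.
- by move=> i; apply: symb_cst; [exact: decay_ge0|exact: W1].
Qed.

Lemma coord_le_bracket2 X i : `|X i 0| <= U X `^ 2^-1.
Proof.
rewrite powR12_sqrt ?bracket2_ge0 //.
rewrite -sqrtr_sqr; apply: ler_wsqrtr.
by apply: le_trans (sqr_coord_le X i) _; rewrite /bracket2 lerDr.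
Qed.

Lemma symb_coord i : symb lam (fun X => U X `^ 2^-1) (fun X => X i 0).
Proof.
have -> : (fun X : 'cV[R]_d => X i 0) = bil 1%:M (delta_mx i 0).
  by apply/funext => X; rewrite bil1_delta.
apply: symb_linear0; exists 1 => // X; rewrite mul1r.
  by rewrite bil1_delta coord_le_bracket2.
rewrite /decay -bracket2_powD -[X in X <= _](powRr0 (U X)) bracket2_pow_le //.
by have := s_le1; lra.
Qed.

Lemma symb_bracket2 : symb lam U U.
Proof.
apply: (@symb_ode R d lam decay_ge0 U U
    (fun _ _ => 0) (fun i X => 2 * X i 0) 0).
- have -> : U = (fun X => U X `^ 1).
    by apply/funext => X; rewrite powRr1 // bracket2_ge0.
  exact: continuous_bracket2_pow.
- by exists 1 => // X; rewrite mul1r ger0_norm // bracket2_ge0.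
- move=> i X; apply: is_derive_eq; first exact: is_derive_bracket2.
  by rewrite !mul0r add0r.
- by move=> i n; apply: symb_upto0; exact: decay_ge0.
- move=> i; apply: symbZ; first exact: decay_ge0.
  apply: (symb_le decay_ge0 ler01 _ (symb_coord i)) => X; rewrite mul1r.
  rewrite -[X in _ <= X * _]powRr1 ?bracket2_ge0 // /decay -bracket2_powD.
  by rewrite bracket2_pow_le //; have := s_le1; lra.
Qed.

Lemma symb_logder i : symb lam lam (logder i).
Proof.
have sV : symb lam (fun X => (U X)^-1) (fun X => (U X)^-1).
  apply: (symbV decay_ge0 ltr01 bracket2_gt0 _ symb_bracket2) => X.
  by rewrite mul1r.
apply: (symb_le decay_ge0 ler01 _ (symbM decay_ge0 (symb_coord i) sV)) => X.
rewrite mul1r -(powR_inv1 (bracket2_ge0 X)) -bracket2_powD.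
by rewrite bracket2_pow_le //; have := s_le1; lra.
Qed.

Lemma symb_pow_mul (p : R) W (h : 'cV[R]_d -> R) (dh : 'I_d -> 'cV[R]_d -> R) :
  continuous h -> (forall i X, is_derive X (delta_mx i 0) h (dh i X)) ->
  (exists2 C : R, 0 <= C & forall X, `|U X `^ p * h X| <= C * W X) ->
  (forall i, symb lam (fun X => W X * lam X) (fun X => U X `^ p * dh i X)) ->
  symb lam W (fun X => U X `^ p * h X).
Proof.
move=> hc hd hW hs.
apply: (@symb_ode R d lam decay_ge0 W (fun X => U X `^ p * h X) logder
    (fun i X => U X `^ p * dh i X) (2 * p)).
- move=> X; apply: (@continuousM R _ (fun X => U X `^ p) h); last exact: hc.
  exact: continuous_bracket2_pow.
- exact: hW.
- move=> i X.
  have h1 := is_deriveM (is_derive_bracket2_pow p X i) (hd i X).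
  apply: is_derive_eq h1 _.
  by rewrite /GRing.scale /=; ring.
- exact: symb_logder.
- exact: hs.
Qed.

Lemma symb_bracket2_pow (p : R) : symb lam (fun X => U X `^ p) (fun X => U X `^ p).
Proof.
have U0 X : 0 <= U X `^ p by exact: ltW (bracket2_pow_gt0 X p).
suff : symb lam (fun X => U X `^ p) (fun X => U X `^ p * cst 1 X).
  have -> : (fun X => U X `^ p * cst 1 X) = (fun X => U X `^ p) by apply/funext => X; rewrite mulr1.
  by [].
apply: (@symb_pow_mul p (fun X => U X `^ p) (cst 1) (fun _ _ => 0)).
- exact: cst_continuous.
- by exists 1 => // X; rewrite /cst mulr1 mul1r ger0_norm.
- move=> i n; have -> : (fun X => U X `^ p * 0) = fun=> 0.
    by apply/funext => X; rewrite mulr0.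
  apply: symb_upto0; first exact: decay_ge0.
  by move=> X; rewrite !mulr_ge0 // decay_ge0.
Qed.

Lemma symb_pow_linear (p : R) W M V :
  (exists2 C : R, 0 <= C & forall X, `|U X `^ p * bil M V X| <= C * W X) ->
  (exists2 C : R, 0 <= C & forall X, U X `^ p <= C * (W X * lam X)) ->
  symb lam W (fun X => U X `^ p * bil M V X).
Proof.
move=> hb [C C0 hW].
apply: (@symb_pow_mul p W (bil M V) (fun i _ => bil M V (delta_mx i 0))).
- exact: continuous_bilr.
- by move=> i X; exact: is_derive_bilr.
- exact: hb.
- move=> i; have -> : (fun X => U X `^ p * bil M V (delta_mx i 0)) =
      (fun X => bil M V (delta_mx i 0) * U X `^ p).
    by apply/funext => X; rewrite mulrC.
  apply: symbZ; first exact: decay_ge0.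
  exact: (symb_le decay_ge0 C0 hW (symb_bracket2_pow p)).
Qed.

(** For a quadratic form times a power of <X>, the symbol estimates follow from
bounds at orders 0, 1 and 2. *)
Lemma symb_pow_quad (p : R) W M :
  (exists2 C : R, 0 <= C & forall X, `|U X `^ p * bil M X X| <= C * W X) ->
  (forall i, exists2 C : R, 0 <= C & forall X,
     `|U X `^ p * bil (M + M^T) (delta_mx i 0) X| <= C * (W X * lam X)) ->
  (exists2 C : R, 0 <= C & forall X, U X `^ p <= C * (W X * lam X * lam X)) ->
  symb lam W (fun X => U X `^ p * bil M X X).
Proof.
move=> hb hd hW.
apply: (@symb_pow_mul p W (fun X => bil M X X)
  (fun i X => bil (M + M^T) (delta_mx i 0) X)).
- exact: continuous_quad.
- by move=> i X; exact: is_derive_quad.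
- exact: hb.
- by move=> i; exact: symb_pow_linear.
Qed.

End Weights.

(** * Iterated forms and directional derivatives *)

Section Gram.
Context {R : realType} {d N : nat} (B : 'I_N -> 'M[R]_d) (G : 'M[R]_d).
Hypotheses (G_sym : G^T = G) (G_psd : forall X, 0 <= bil G X X).

(** The matrix of the form X |-> sum_l M(B_l X, B_l X). *)
Definition gram_step (M : 'M[R]_d) : 'M[R]_d := \sum_l (B l)^T *m M *m B l.

(** The matrix of r_k. *)
Definition gram (k : nat) : 'M[R]_d := iter k gram_step G.

Lemma bil_gram_step M X Y :
  bil (gram_step M) X Y = \sum_l bil M (B l *m X) (B l *m Y).
Proof.
rewrite bil_mx_sum; apply: eq_bigr => l _.
by rewrite bil_mulmxr bil_mulmxl.
Qed.

Lemma bil_gramS k X :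
  bil (gram k.+1) X X = \sum_l bil (gram k) (B l *m X) (B l *m X).
Proof. exact: bil_gram_step. Qed.

Lemma gram_sym k : (gram k)^T = gram k.
Proof.
elim: k => [//|k IH]; rewrite /gram /= -/(gram k) /gram_step linear_sum /=.
by apply: eq_bigr => l _; rewrite !trmx_mul trmxK IH mulmxA.
Qed.

Lemma bil_gramC k X Y : bil (gram k) X Y = bil (gram k) Y X.
Proof. by rewrite -bil_trmx gram_sym. Qed.

Lemma gram_psd k X : 0 <= bil (gram k) X X.
Proof.
elim: k X => [//|k IH] X; rewrite bil_gramS; exact: sumr_ge0.
Qed.

Lemma gram_le_step k l X :
  bil (gram k) (B l *m X) (B l *m X) <= bil (gram k.+1) X X.
Proof.
rewrite bil_gramS (bigD1 l) //= lerDl; apply: sumr_ge0 => j _.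
exact: gram_psd.
Qed.

Lemma bil_gram_young k X Y (mu : R) : 0 < mu ->
  `|bil (gram k) X Y| <= mu * bil (gram k) X X + mu^-1 * bil (gram k) Y Y.
Proof. by apply: bil_young; [exact: gram_sym|exact: gram_psd]. Qed.

End Gram.

Section DirectionalDerivative.
Context {R : realType} {d : nat}.
Implicit Types (M B : 'M[R]_d) (X : 'cV[R]_d) (f g : 'cV[R]_d -> R).

(** The derivative of f along the linear vector field X |-> B X. *)
Definition along B f X : R := \sum_i (B *m X) i 0 * partial i f X.

(** All first partial derivatives exist, at every point. *)
Definition has_partials f := forall i X, derivable f X (delta_mx i 0).

Lemma symb_has_partials (lam W f : 'cV[R]_d -> R) :
  symb lam W f -> has_partials f.
Proof. by move=> sf i X; have [_ _ /(_ i) []] := sf 1%N. Qed.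

Lemma alongD B f g X : has_partials f -> has_partials g ->
  along B (fun X => f X + g X) X = along B f X + along B g X.
Proof.
move=> df dg; rewrite -big_split /=; apply: eq_bigr => i _.
by rewrite partialD // mulrDr.
Qed.

Lemma along_sum (k : nat) B (F : 'I_k -> 'cV[R]_d -> R) X :
  (forall j, has_partials (F j)) ->
  along B (fun X => \sum_j F j X) X = \sum_j along B (F j) X.
Proof.
move=> dF; rewrite /along exchange_big /=; apply: eq_bigr => i _.
rewrite -mulr_sumr; congr (_ * _); rewrite /partial.
have -> : (fun X => \sum_j F j X) = \sum_j F j.
  by apply/funext => Y; rewrite fct_sumE.
by rewrite derive_sum // => j; exact: dF.
Qed.

Lemma alongZ (c : R) B f X : has_partials f ->
  along B (fun X => c * f X) X = c * along B f X.
Proof.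
move=> df; rewrite mulr_sumr; apply: eq_bigr => i _.
rewrite partialM //.
by rewrite partial_cst mulr0 addr0 mulrCA.
Qed.

Lemma along_div B f g X : has_partials f -> has_partials g ->
  (forall X, g X != 0) ->
  along B (fun X => f X / g X) X =
  along B f X / g X - f X * along B g X / g X ^+ 2.
Proof.
move=> df dg g0.
rewrite /along mulr_suml mulr_sumr mulr_suml -sumrB; apply: eq_bigr => i _.
rewrite (@partialM _ _ i f (fun X => (g X)^-1)) //; last first.
  by move=> Y; apply: derivableV.
by rewrite partialV //; field.
Qed.

Lemma along_pow_quad (p : R) B M X :
  along B (fun X => bracket2 X `^ p * bil M X X) X =
  2 * p * (\sum_i (B *m X) i 0 * logder i X) *
    (bracket2 X `^ p * bil M X X) +
  bracket2 X `^ p * bil (M + M^T) (B *m X) X.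
Proof.
rewrite -(sum_bil_delta _ (B *m X)) !mulr_sumr mulr_suml -big_split /=.
apply: eq_bigr => i _.
have [_ E] := is_deriveM (is_derive_bracket2_pow p X i)
  (is_derive_quad M X (delta_mx i 0)).
by rewrite /partial [X in _ * X]E /GRing.scale /=; ring.
Qed.

End DirectionalDerivative.

(** * Levels, cross terms and energy *)

Section Weight.
Context {R : realType} {d N : nat} (B : 'I_N -> 'M[R]_d) (G : 'M[R]_d).
Hypotheses (G_sym : G^T = G) (G_psd : forall X, 0 <= bil G X X).
Context (m : nat).
Implicit Types (X : 'cV[R]_d).

Local Notation U := bracket2.
Local Notation gram := (gram B G).

(** The exponent s = 1/(2m+1); T is <X>^(2s). *)
Definition rate : R := (2 * m + 1)%:R^-1.
Local Notation s := rate.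
Local Notation lam := (decay s).

(** a_k = T^(-2k) r_k. *)
Definition level (k : nat) X : R :=
  U X `^ (- (s * (2 * k)%:R)) * bil (gram k) X X.

(** T^(-(2k+1)) r_k(X, B_l X). *)
Definition cross (k : nat) (l : 'I_N) X : R :=
  U X `^ (- (s * (2 * k + 1)%:R)) * bil (gram k *m B l) X X.

(** T^(-(2k+2)) times the derivative of r_k(X, B_l X) along B_l X. *)
Definition cross_gain (k : nat) (l : 'I_N) X : R :=
  U X `^ (- (s * (2 * k + 2)%:R)) *
  (bil (gram k) (B l *m X) (B l *m X) + bil (gram k) X (B l *m (B l *m X))).

(** Logarithmic derivative of 1/T along B_l X. *)
Definition drift (l : 'I_N) X : R :=
  - (2 * s) * \sum_i (B l *m X) i 0 * logder i X.

(** Q. *)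
Definition energy X : R := U X `^ s + \sum_(k < m.+1) level k X.

Lemma rate_gt0 : 0 < s.
Proof. by rewrite invr_gt0 ltr0n addn1. Qed.

Lemma rate_le1 : s <= 1.
Proof. by rewrite invf_le1 ?ltr0n ?addn1 // ler1n. Qed.

Lemma rateE : s * (2 * m + 1)%:R = 1.
Proof. by rewrite mulVf // pnatr_eq0 addn1. Qed.

Lemma level_ge0 k X : 0 <= level k X.
Proof. by rewrite mulr_ge0 ?gram_psd // ltW // bracket2_pow_gt0. Qed.

Lemma weight_le_energy X : U X `^ s <= energy X.
Proof. by rewrite lerDl sumr_ge0 // => k _; exact: level_ge0. Qed.

Lemma level_le_energy k X : (k <= m)%N -> level k X <= energy X.
Proof.
move=> km; rewrite /energy (bigD1 (Ordinal (km : (k < m.+1)%N))) //= addrCA.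
rewrite lerDl addr_ge0 //; first by rewrite ltW // bracket2_pow_gt0.
by apply: sumr_ge0 => j _; exact: level_ge0.
Qed.

Lemma energy_gt0 X : 0 < energy X.
Proof. exact: lt_le_trans (bracket2_pow_gt0 X s) (weight_le_energy X). Qed.

Lemma cross_young k l X (mu : R) : 0 < mu ->
  `|cross k l X| <= mu * level k X + mu^-1 * level k.+1 X.
Proof.
move=> mu0; have U0 := bracket2_pow_gt0 X s.
rewrite normrM (gtr0_norm (bracket2_pow_gt0 _ _)) bil_mulmxr.
have := bil_gram_young B G_sym G_psd k X (B l *m X) (mulr_gt0 mu0 U0).
move=> /(ler_wpM2l (ltW (bracket2_pow_gt0 X (- (s * (2 * k + 1)%:R))))).
move/le_trans; apply.
rewrite mulrDr lerD //.
  have -> : U X `^ (- (s * (2 * k + 1)%:R)) *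
      (mu * U X `^ s * bil (gram k) X X) =
    mu * ((U X `^ (- (s * (2 * k + 1)%:R)) * U X `^ s) * bil (gram k) X X) by ring.
  rewrite -bracket2_powD /level le_eqVlt; apply/orP; left; apply/eqP.
  by congr (_ * (_ * _)); congr (_ `^ _); rewrite natrD; ring.
have -> : U X `^ (- (s * (2 * k + 1)%:R)) *
    ((mu * U X `^ s)^-1 * bil (gram k) (B l *m X) (B l *m X)) =
  mu^-1 * ((U X `^ (- (s * (2 * k + 1)%:R)) * U X `^ (- s)) *
    bil (gram k) (B l *m X) (B l *m X)) by rewrite invfM (powRN _ s); ring.
rewrite -bracket2_powD ler_wpM2l ?invr_ge0 ?(ltW mu0) //.
have -> : - (s * (2 * k + 1)%:R) - s = - (s * (2 * k.+1)%:R).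
  by rewrite mulnS !natrD; ring.
by rewrite /level ler_wpM2l ?gram_le_step //; exact: ltW (bracket2_pow_gt0 _ _).
Qed.

Lemma cross_gain_ge k X (mu : R) : 0 < mu ->
  level k.+1 X - N%:R * (mu * level k X + mu^-1 * level k.+2 X) <=
  \sum_l cross_gain k l X.
Proof.
move=> mu0; have U0 := bracket2_pow_gt0 X (2 * s).
pose p := - (s * (2 * k + 2)%:R).
have Up0 : 0 <= U X `^ p by exact: ltW (bracket2_pow_gt0 _ _).
rewrite /cross_gain -/p -mulr_sumr big_split /= -bil_gramS.
rewrite [leRHS]mulrDr.
have -> : level k.+1 X = U X `^ p * bil (gram k.+1) X X.
  by rewrite /level /p mulnS addnC.
rewrite lerD2l mulr_sumr lerNl -sumrN.
rewrite mulr_natl -[X in _ *+ X]card_ord -sumr_const; apply: ler_sum => l _.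
apply: le_trans (ler_norm _) _; rewrite normrN normrM ger0_norm //.
have := bil_gram_young B G_sym G_psd k X (B l *m (B l *m X)) (mulr_gt0 mu0 U0).
move=> /(ler_wpM2l Up0)/le_trans; apply; rewrite mulrDr lerD //.
  have -> : U X `^ p * (mu * U X `^ (2 * s) * bil (gram k) X X) =
    mu * ((U X `^ p * U X `^ (2 * s)) * bil (gram k) X X) by ring.
  rewrite -bracket2_powD /level le_eqVlt; apply/orP; left; apply/eqP.
  by congr (_ * (_ * _)); congr (_ `^ _); rewrite /p natrD; ring.
have -> : U X `^ p * ((mu * U X `^ (2 * s))^-1 *
    bil (gram k) (B l *m (B l *m X)) (B l *m (B l *m X))) =
  mu^-1 * ((U X `^ p * U X `^ (- (2 * s))) *
    bil (gram k) (B l *m (B l *m X)) (B l *m (B l *m X))).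
  by rewrite invfM (powRN _ (2 * s)); ring.
rewrite -bracket2_powD ler_wpM2l ?invr_ge0 ?(ltW mu0) // /level.
have -> : p - 2 * s = - (s * (2 * k.+2)%:R).
  by rewrite /p !mulnS !natrD; ring.
rewrite ler_wpM2l ?(ltW (bracket2_pow_gt0 _ _)) //.
apply: le_trans (gram_le_step B G_psd k.+1 l X).
exact: gram_le_step.
Qed.

Lemma pow_le_energy_decay X (r : R) : r <= s / 2 -> U X `^ r <= energy X * lam X.
Proof.
move=> rs; apply: (@le_trans _ _ (U X `^ s * lam X)).
  by rewrite /decay -bracket2_powD bracket2_pow_le //; lra.
by rewrite ler_wpM2r ?decay_ge0 // weight_le_energy.
Qed.

Lemma pow_le_energy_decay2 X (r : R) : r <= 0 ->
  U X `^ r <= energy X * lam X * lam X.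
Proof.
move=> r0; apply: (@le_trans _ _ (U X `^ s * lam X * lam X)).
  by rewrite /decay -!bracket2_powD bracket2_pow_le //; lra.
by rewrite !ler_wpM2r ?decay_ge0 // weight_le_energy.
Qed.

Lemma symb_level k : (k <= m)%N -> symb lam energy (level k).
Proof.
move=> km; have s0 := rate_gt0.
have sk : 0 <= s * (2 * k)%:R by rewrite mulr_ge0 // ltW.
apply: (symb_pow_quad rate_le1).
- exists 1 => // X; rewrite mul1r -/(level k X) ger0_norm ?level_ge0 //.
  exact: level_le_energy.
(* Cauchy-Schwarz with parameter <X>^s balances the two factors. *)
- move=> i; set e := delta_mx i 0; exists (2 * (bil (gram k) e e + 1)).
    by rewrite mulr_ge0 // addr_ge0 // gram_psd.
  move=> X; rewrite (gram_sym B G_sym) bil_mxD -mulr2n -[_ *+ 2]mulr_natl mulrCA normrM normr_nat -mulrA.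
  rewrite ler_wpM2l // normrM (gtr0_norm (bracket2_pow_gt0 _ _)).
  have := bil_gram_young B G_sym G_psd k e X (bracket2_pow_gt0 X (s / 2)).
  move=> /(ler_wpM2l (ltW (bracket2_pow_gt0 X (- (s * (2 * k)%:R))))).
  move/le_trans; apply; rewrite [leLHS]mulrDr [leRHS]mulrDl lerD //.
    rewrite [leLHS]mulrA -bracket2_powD [leLHS]mulrC ler_wpM2l ?gram_psd //.
    by apply: pow_le_energy_decay; lra.
  rewrite mul1r -powRN [leLHS]mulrCA -/(level k X) [leLHS]mulrC /decay.
  by rewrite ler_wpM2r ?(ltW (bracket2_pow_gt0 _ _)) // level_le_energy.
- exists 1 => // X; rewrite mul1r; apply: pow_le_energy_decay2; lra.
Qed.

Lemma symb_cross k l : (k < m)%N -> symb lam energy (cross k l).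
Proof.
move=> km; have s0 := rate_gt0.
have sk : 0 <= s * (2 * k)%:R by rewrite mulr_ge0 // ltW.
have pE : - (s * (2 * k + 1)%:R) = - (s * (2 * k)%:R) - s.
  by rewrite natrD; ring.
apply: (symb_pow_quad rate_le1).
- exists 2 => // X; rewrite -/(cross k l X).
  apply: le_trans (cross_young k l X ltr01) _.
  rewrite invr1 !mul1r mulrDl mul1r lerD ?level_le_energy //.
  exact: ltnW.
(* Cauchy-Schwarz with parameter <X>^(3s) against level k+1, and with
   parameter <X>^s against level k. *)
- move=> i; set e := delta_mx i 0.
  exists ((bil (gram k) e e + 1) + (1 + bil (gram k) (B l *m e) (B l *m e))).
    by rewrite !addr_ge0 // gram_psd.
  move=> X; rewrite bil_mxD bil_trmx !bil_mulmxr [X in Num.norm X]mulrDr [leRHS]mulrDl.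
  have U0 r := ltW (bracket2_pow_gt0 X r).
  apply: le_trans (ler_normD _ _) _; rewrite !normrM (ger0_norm (U0 _)) pE.
  apply: lerD.
    have := bil_gram_young B G_sym G_psd k e (B l *m X)
      (bracket2_pow_gt0 X (3 * s / 2)).
    move=> /(ler_wpM2l (U0 (- (s * (2 * k)%:R) - s)))/le_trans; apply.
    rewrite [leLHS]mulrDr [leRHS]mulrDl lerD //.
      rewrite [leLHS]mulrA -bracket2_powD [leLHS]mulrC ler_wpM2l ?gram_psd //.
      by apply: pow_le_energy_decay; lra.
    rewrite mul1r -powRN [leLHS]mulrA -bracket2_powD.
    have -> : - (s * (2 * k)%:R) - s - 3 * s / 2 =
        - (s * (2 * k.+1)%:R) - (s / 2) by rewrite mulnS natrD; lra.
    rewrite bracket2_powD /decay [leLHS]mulrAC ler_wpM2r //.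
    apply: le_trans (level_le_energy X km); rewrite /level ler_wpM2l //.
    exact: gram_le_step.
  have := bil_gram_young B G_sym G_psd k X (B l *m e)
      (bracket2_pow_gt0 X (s / 2)).
  move=> /(ler_wpM2l (U0 (- (s * (2 * k)%:R) - s)))/le_trans; apply.
  rewrite [leLHS]mulrDr [leRHS]mulrDl lerD //.
    rewrite mul1r [leLHS]mulrA -bracket2_powD.
    have -> : - (s * (2 * k)%:R) - s + s / 2 =
        - (s * (2 * k)%:R) - (s / 2) by lra.
    rewrite bracket2_powD /decay [leLHS]mulrAC ler_wpM2r //.
    exact: level_le_energy (ltnW km).
  rewrite -powRN [leLHS]mulrA -bracket2_powD [leLHS]mulrC ler_wpM2l ?gram_psd //.
  by apply: pow_le_energy_decay; lra.
- by exists 1 => // X; rewrite mul1r pE; apply: pow_le_energy_decay2; lra.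
Qed.

Lemma symb_energy : symb lam energy energy.
Proof.
apply: (@symbD R d lam energy (fun X => U X `^ s)
  (fun X => \sum_(k < m.+1) level k X)).
  apply: (symb_le (decay_ge0 s) ler01 _ (symb_bracket2_pow rate_le1 s)) => X.
  by rewrite mul1r weight_le_energy.
apply: (@symb_sum R d lam (decay_ge0 s) m.+1 energy (fun k => level k)) => [X|j].
  exact: ltW (energy_gt0 X).
by apply: symb_level; rewrite -ltnS.
Qed.

Lemma along_level k l X :
  along (B l) (level k) X =
  2 * U X `^ s * cross k l X + (2 * k)%:R * drift l X * level k X.
Proof.
rewrite along_pow_quad addrC; congr (_ + _).
  rewrite (gram_sym B G_sym) bil_mxD (bil_gramC B G_sym k (B l *m X)).
  rewrite -mulr2n -[_ *+ 2]mulr_natl mulrCA -mulrA; congr (_ * _).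
  rewrite /cross bil_mulmxr mulrA -bracket2_powD; congr (_ `^ _ * _).
  by rewrite natrD; ring.
by rewrite /drift /level; ring.
Qed.

Lemma along_cross k l X :
  along (B l) (cross k l) X =
  U X `^ s * cross_gain k l X + (2 * k + 1)%:R * drift l X * cross k l X.
Proof.
rewrite along_pow_quad addrC; congr (_ + _); last by rewrite /drift /cross; ring.
rewrite bil_mxD bil_trmx !bil_mulmxr mulrA -bracket2_powD; congr (_ `^ _ * _).
by rewrite !natrD; ring.
Qed.

Lemma along_energy l X :
  along (B l) energy X = - drift l X * U X `^ s +
    \sum_(k < m.+1) (2 * U X `^ s * cross k l X
                     + (2 * k)%:R * drift l X * level k X).
Proof.
have dl (k : 'I_m.+1) : has_partials (level k).
  by apply: symb_has_partials (symb_level _); rewrite -ltnS.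
rewrite (@alongD R d (B l) (fun X => U X `^ s)
  (fun X => \sum_(k < m.+1) level k X)); first last.
- apply: symb_has_partials.
  apply: (@symb_sum R d lam (decay_ge0 s) m.+1 energy (fun k => level k)) => [Y|j].
    exact: ltW (energy_gt0 Y).
  by apply: symb_level; rewrite -ltnS.
- exact: symb_has_partials (symb_bracket2_pow rate_le1 s).
rewrite along_sum //; congr (_ + _); last first.
  by apply: eq_bigr => k _; rewrite along_level.
rewrite /along /drift -mulNr opprK mulr_sumr mulr_suml; apply: eq_bigr => i _.
have [_ E] := is_derive_bracket2_pow s X i.
by rewrite /partial E; ring.
Qed.

Lemma drift_bound : exists2 C : R, 0 <= C & forall l X, `|drift l X| <= C.
Proof.
have H l := bil_bound (B l).
have [C C0 HC] : exists2 C : R, 0 <= C &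
    forall l X, `|bil (B l) X X| <= C * sqnorm X.
  have /boolp.choice [C HC] : forall l, exists C : R, 0 <= C /\
      forall X, `|bil (B l) X X| <= C * sqnorm X.
    by move=> l; have [C C0 HC] := H l; exists C.
  exists (\sum_l C l); first by apply: sumr_ge0 => l _; have [] := HC l.
  move=> l X; have [_ /(_ X)/le_trans] := HC l; apply.
  rewrite ler_wpM2r ?sqnorm_ge0 // (bigD1 l) //= lerDl; apply: sumr_ge0 => j _.
  by have [] := HC j.
exists (2 * s * C); first by rewrite !mulr_ge0 // ltW // rate_gt0.
move=> l X.
have -> : drift l X = - (2 * s) * (bil (B l) X X / U X).
  rewrite /drift; congr (_ * _).
  rewrite -[B l]mul1mx bil_mulmxr -bil_trmx trmx1 -sum_bil_delta mulr_suml.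
  by apply: eq_bigr => i _; rewrite bil1_delta mul1mx /logder mulrA.
have U0 := bracket2_gt0 X.
have s2 : 0 <= 2 * s by rewrite mulr_ge0 // ltW // rate_gt0.
rewrite normrM normrN (ger0_norm s2) ler_wpM2l //.
rewrite normrM normfV (gtr0_norm U0) ler_pdivrMr //.
by apply: le_trans (HC l X) _; rewrite ler_wpM2l // lerDr.
Qed.

(** The choice of s makes T^(-(2m+2)) <X>^2 equal to 1/T. *)
Lemma level_top_bound : exists2 C : R, 0 <= C & forall X, level m.+1 X <= C.
Proof.
have [C C0 HC] := bil_bound (gram m.+1).
exists C => // X; rewrite /level.
have U0 := bracket2_gt0 X.
apply: (@le_trans _ _ (U X `^ (- (s * (2 * m.+1)%:R)) * (C * U X))).
  rewrite ler_wpM2l ?(ltW (bracket2_pow_gt0 _ _)) //.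
  apply: le_trans (ler_norm _) _; apply: le_trans (HC X) _.
  by rewrite ler_wpM2l // lerDr.
rewrite mulrCA -[X in C * (_ * X)]powRr1 ?(ltW U0) // -bracket2_powD.
rewrite ler_piMr // -[X in _ <= X](powRr0 (U X)) bracket2_pow_le //.
have := rateE; have := rate_gt0; rewrite mulnS !natrD mulrDr; lra.
Qed.

End Weight.

(** * Weights for linear vector fields *)

(** Harmonic-mean bound: T S / (T + S) is comparable to min (T, S). *)
Lemma harmonic_gain {R : realFieldType} (T S c0 : R) :
  1 <= T -> 0 <= S -> 0 < c0 -> c0 * (T - 1) <= S ->
  Num.min c0 1 / 2 * (T - 1) <= T * S / (T + S).
Proof.
move=> T1 S0 c00 h.
have TS0 : 0 < T + S by rewrite ltr_wpDr // (lt_le_trans ltr01).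
rewrite ler_pdivlMr //.
set c1 := Num.min c0 1.
have c1c0 : c1 <= c0 by rewrite ge_min lexx.
have c11 : c1 <= 1 by rewrite ge_min lexx orbT.
have c10 : 0 < c1 by rewrite lt_min c00 ltr01.
have cS : c1 * (T - 1) <= S.
  by apply: le_trans h; rewrite ler_wpM2r // subr_ge0.
have cT : c1 * (T - 1) <= T.
  apply: (@le_trans _ _ (1 * (T - 1))); last by lra.
  by rewrite ler_wpM2r // subr_ge0.
set w := c1 * (T - 1) in cS cT.
have -> : c1 / 2 * (T - 1) * (T + S) = (w * T + w * S) / 2.
  by rewrite /w; field.
have T0 : 0 <= T by lra.
have h1 := ler_wpM2r T0 cS; have h2 := ler_wpM2r S0 cT; lra.
Qed.

(** The statement for arbitrary linear vector fields B_l and an arbitrary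
nonnegative quadratic form G, with symbols defined on the whole space. *)
Lemma subelliptic_multipliers {R : realType} {d N : nat}
    (B : 'I_N -> 'M[R]_d) (G : 'M[R]_d) (m : nat)
    (Om : set 'cV[R]_d) (c0 : R) :
  (0 < N)%N -> G^T = G -> (forall X, 0 <= bil G X X) -> 0 < c0 ->
  (forall X, Om X ->
     c0 * sqnorm X <= \sum_(k < m.+1) bil (gram B G k) X X) ->
  exists (g : 'I_N -> 'cV[R]_d -> R) (c kap : R),
    [/\ forall l, symb (decay (rate m)) (fun=> 1) (g l), 0 < c, 0 < kap &
     forall X, Om X -> c * bracket2 X `^ rate m <=
       1 + bil G X X + kap * \sum_l along (B l) (g l) X].
Proof.
move=> N0 Gs Gp c00 hyp.
have [Cth Cth0 thC] := @drift_bound R d N B m.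
have [Ca Ca0 aCa] := @level_top_bound R d N B G m.
pose C2 := Cth + 2 * (2 + Ca) + (2 * m)%:R * Cth.
pose K := N%:R * (1 + C2 + (2 * m + 1)%:R * Cth).
have K0 : 0 < K.
  rewrite /K pmulr_rgt0 ?ltr0n // -addrA ltr_wpDr // addr_ge0 ?mulr_ge0 //.
  by rewrite /C2 !addr_ge0 ?mulr_ge0 // addr_ge0.
have [c [lam [C [cge lamgt Cge hc]]]] := hypocoercive_coefficients m K0.
pose s : R := rate m.
have s0 : 0 < s := rate_gt0 m; have s1 : s <= 1 := rate_le1 m.
pose Q := @energy R d N B G m.
pose P l := fun X => \sum_(k < m) c k * @cross R d N B G m k l X.
pose g l := fun X => P l X / Q X.
have Q0 X : Q X != 0 by rewrite gt_eqF //; exact: energy_gt0.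
have sQ : symb (decay s) Q Q := symb_energy B Gs Gp m.
have sP l : symb (decay s) Q (P l).
  apply: (@symb_sum R d _ (decay_ge0 s) m Q
    (fun k X => c k * @cross R d N B G m k l X)) => [X|k].
    by apply: ltW; exact: energy_gt0.
  by apply: symbZ; [exact: decay_ge0|exact: symb_cross].
have gainX X : Om X -> Num.min c0 1 / 2 * (bracket2 X `^ s - 1)
    - (C + 1) * bil G X X - C * Ca <= \sum_l along (B l) (g l) X.
  move=> OmX.
  have T1 : 1 <= bracket2 X `^ s.
    by rewrite -[X in X <= _](powRr0 (bracket2 X)) bracket2_pow_le // ltW.
  have a0 : level B G m 0 X = bil G X X.
    by rewrite /level muln0 mulr0 oppr0 powRr0 mul1r.
  have := @pointwise_gain R N m (bracket2 X `^ s) Cth Ca C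
    (fun k => level B G m k X) c lam (fun l => drift B m l X)
    (fun k l => cross B G m k l X) (fun k l => cross_gain B G m k l X)
    T1 (fun k => level_ge0 B Gp m k X) (aCa X) Cge cge lamgt
    (fun l => thC l X) (fun k l mu => @cross_young _ _ _ B G Gs Gp m k l X mu)
    (fun k mu => @cross_gain_ge _ _ _ B G Gs Gp m k X mu)
    (hc _ (fun k => level_ge0 B Gp m k X)).
  rewrite a0 => H.
  apply: (@le_trans _ _ (bracket2 X `^ s * (\sum_(k < m.+1) level B G m k X) /
    (bracket2 X `^ s + \sum_(k < m.+1) level B G m k X)
      - (C + 1) * bil G X X - C * Ca)).
    rewrite !lerD2r; apply: harmonic_gain => //.
      by apply: sumr_ge0 => k _; exact: level_ge0.
    (* Every a_k, k <= m, is at least T^(-2m) r_k. *)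
    apply: (@le_trans _ _ (bracket2 X `^ (- (s * (2 * m)%:R)) *
        (\sum_(k < m.+1) bil (gram B G k) X X))); last first.
      rewrite mulr_sumr; apply: ler_sum => k _.
      rewrite ler_wpM2r ?gram_psd // bracket2_pow_le // lerN2 ler_wpM2l ?(ltW s0) //.
      by rewrite ler_nat leq_mul2l -ltnS ltn_ord orbT.
    apply: (@le_trans _ _ (bracket2 X `^ (- (s * (2 * m)%:R)) *
        (c0 * sqnorm X))); last first.
      by rewrite ler_wpM2l ?hyp //; exact: ltW (bracket2_pow_gt0 _ _).
    have -> : sqnorm X = bracket2 X `^ 1 - 1.
      by rewrite powRr1 ?bracket2_ge0 // /bracket2 addrC addKr.
    rewrite mulrCA ler_wpM2l ?(ltW c00) // mulrBr -bracket2_powD mulr1.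
    have -> : - (s * (2 * m)%:R) + 1 = s.
      by have := @rateE R m; rewrite -/s natrD mulrDr; lra.
    rewrite lerD2l lerN2 -[X in _ <= X](powRr0 (bracket2 X)) bracket2_pow_le //.
    by rewrite oppr_le0 mulr_ge0 // ltW.
  apply: le_trans H _; rewrite le_eqVlt; apply/orP; left; apply/eqP.
  apply: eq_bigr => l _; rewrite /g along_div //; first last.
  - exact: symb_has_partials sQ.
  - exact: symb_has_partials (sP l).
  rewrite (along_energy B Gs Gp) {2}/P along_sum; last first.
    move=> k; apply: symb_has_partials (symbZ (decay_ge0 s) _ (symb_cross B Gs Gp _ _)).
    exact: ltn_ord.
  congr (_ / _ - _); apply: eq_bigr => k _.
  rewrite alongZ ?along_cross //.
  exact: symb_has_partials (symb_cross B Gs Gp _ (ltn_ord k)).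
pose c1 := Num.min c0 1 / 2.
have c10 : 0 < c1 by rewrite divr_gt0 // lt_min c00 ltr01.
rewrite -/c1 in gainX; clearbody c1.
(* Multiplying the weights by 1/D makes (C + 1) r_0 at most r_0 and the
   remaining constant at most 1. *)
pose D := (C + 1) + (c1 + C * Ca).
have CCa : 0 <= C * Ca by rewrite mulr_ge0.
have D0 : 0 < D by rewrite /D; lra.
exists g, (D^-1 * c1), D^-1; split.
- move=> l; apply: (symb_le (decay_ge0 s) ler01 _ (symbM (decay_ge0 s) (sP l)
    (symbV (decay_ge0 s) ltr01 _ _ sQ))) => X.
  + by rewrite divff // mulr1.
  + exact: energy_gt0.
  + by rewrite mul1r.
- by rewrite mulr_gt0 // invr_gt0.
- by rewrite invr_gt0.
move=> X OmX; have Di : 0 < D^-1 by rewrite invr_gt0.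
have := gainX X OmX; rewrite -/s; set S := \sum_l _; set T := _ `^ _ => H.
rewrite -(ler_pM2l D0) !mulrDr !mulrA divff ?gt_eqF // !mul1r mulr1.
have hG := Gp X; have h2 := mulr_ge0 Cge hG; have h3 := mulr_ge0 (ltW c10) hG.
have h4 := mulr_ge0 CCa hG.
move: H; rewrite /D; lra.
Qed.

(** * Words, Hamilton maps and symbol classes *)

Section TupleSums.
Context {R : realType} {d N : nat} (B : 'I_N -> 'M[R]_d).

Lemma sum_tupleS (A : nmodType) (k : nat) (F : seq 'I_N -> A) :
  \sum_(w : k.+1.-tuple 'I_N) F w =
  \sum_(w : k.-tuple 'I_N) \sum_l F (l :: w).
Proof.
rewrite exchange_big /= pair_big /=.
rewrite (reindex (fun p : 'I_N * k.-tuple 'I_N => [tuple of p.1 :: p.2])) /=.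
  by apply: eq_bigr => p _.
exists (fun w : k.+1.-tuple 'I_N => (thead w, [tuple of behead w])) => [[l w] _|w _].
  by congr (_, _); apply: val_inj.
by case/tupleP: w => l w; apply: val_inj.
Qed.

Lemma bil_gram_words (G : 'M[R]_d) (k : nat) (X : 'cV[R]_d) :
  bil (gram B G k) X X =
  \sum_(w : k.-tuple 'I_N)
    bil G ((\big[mulmx/1%:M]_(a <- w) B a) *m X)
          ((\big[mulmx/1%:M]_(a <- w) B a) *m X).
Proof.
elim: k G => [|k IH] G.
  rewrite (bigD1 [tuple]) //= big1 => [|w /eqP wN]; last by case: wN; rewrite tuple0.
  by rewrite big_nil mul1mx addr0.
rewrite /gram iterSr -/(gram B (gram_step B G) k) IH.
rewrite (sum_tupleS _ (fun w => bil G ((\big[mulmx/1%:M]_(a <- w) B a) *m X)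
          ((\big[mulmx/1%:M]_(a <- w) B a) *m X))).
apply: eq_bigr => w _; rewrite bil_gram_step; apply: eq_bigr => l _.
by rewrite big_cons !mulmxA.
Qed.

End TupleSums.

Section HamiltonMaps.
Context {R : realType} {n : nat}.
Implicit Types (q : 'cV[R]_(n + n) -> R[i]) (F : 'M[R[i]]_(n + n)).
Implicit Types (X Y : 'cV[R]_(n + n)).

Lemma ReZ_real (z : R[i]) (x y : R) :
  complex.Re (real_complex R x * z * real_complex R y) = x * complex.Re z * y.
Proof. by case: z => a b /=; ring. Qed.

Lemma ImZ_real (z : R[i]) (x y : R) :
  complex.Im (real_complex R x * z * real_complex R y) = x * complex.Im z * y.
Proof. by case: z => a b /=; ring. Qed.

(** The real and imaginary parts of a complex quadratic form are given by real
symmetric matrices, M.1 and M.2 respectively. *)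
Lemma quadratic_form_bil q : quadratic_form q ->
  exists M : 'M[R]_(n + n) * 'M[R]_(n + n),
    [/\ M.1^T = M.1, M.2^T = M.2, forall X, re_form q X = bil M.1 X X
      & forall X, im_form q X = bil M.2 X X].
Proof.
move=> [A qA].
pose sym (M : 'M[R]_(n + n)) := 2^-1 *: (M + M^T).
have symT M : (sym M)^T = sym M.
  by rewrite /sym linearZ /= linearD /= trmxK addrC.
have symE M X : bil (sym M) X X = bil M X X.
  have -> : bil (sym M) X X = 2^-1 * bil (M + M^T) X X.
    by rewrite /bil -scalemxAr -scalemxAl mxE.
  by rewrite bil_mxD bil_trmx; field.
have expand X : ((complexify X)^T *m A *m complexify X) 0 0 =
    \sum_i \sum_j (real_complex R (X i 0) * A i j * real_complex R (X j 0)).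
  rewrite mxE exchange_big /=; apply: eq_bigr => j _.
  by rewrite mxE mulr_suml; apply: eq_bigr => i _; rewrite !mxE.
exists (sym (map_mx (@complex.Re R) A), sym (map_mx (@complex.Im R) A)).
split=> //= X; rewrite symE bilE.
  rewrite /re_form qA expand raddf_sum; apply: eq_bigr => i _.
  by rewrite raddf_sum; apply: eq_bigr => j _; rewrite /= ReZ_real mxE.
rewrite /im_form qA expand raddf_sum; apply: eq_bigr => i _.
by rewrite raddf_sum; apply: eq_bigr => j _; rewrite /= ImZ_real mxE.
Qed.

(** The imaginary part of the Hamilton map is the Hamilton map of Im q. *)
Lemma im_hamilton q F (H : 'M[R]_(n + n)) : H^T = H ->
  (forall X, im_form q X = bil H X X) -> is_hamilton_map q F ->
  forall X Y, bil H X Y = \sum_(i < n)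
    (X (rshift n i) 0 * (im_mx F *m Y) (lshift n i) 0
     - X (lshift n i) 0 * (im_mx F *m Y) (rshift n i) 0).
Proof.
move=> sH qH FH X Y.
have ImE (v : 'cV[R]_(n + n)) i (x : R) :
  complex.Im (real_complex R x * (F *m complexify v) i 0) = x * (im_mx F *m v) i 0.
  rewrite !mxE mulr_sumr raddf_sum mulr_sumr; apply: eq_bigr => j _.
  by rewrite /= !mxE mulrA ImZ_real mulrA.
have E : complex.Im (polarized q X Y) = bil H X Y.
  have -> : polarized q X Y = real_complex R 2^-1 * (q (X + Y) - q X - q Y) *
      real_complex R 1.
    rewrite /polarized rmorph1 mulr1 mulrC; congr (_ * _).
    by rewrite fmorphV rmorph_nat.
  rewrite ImZ_real mulr1 !raddfB /= -!/(im_form q _) !qH bilDl !bilDr.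
  have -> : bil H Y X = bil H X Y by rewrite -bil_trmx sH.
  by field.
rewrite -E FH raddf_sum; apply: eq_bigr => i _.
by rewrite raddfB /= -!ImE !mxE.
Qed.

Lemma hamilton_field_along q F (H : 'M[R]_(n + n)) (g : 'cV[R]_(n + n) -> R) X :
  H^T = H -> (forall X, im_form q X = bil H X X) -> is_hamilton_map q F ->
  hamilton_field (im_form q) g X = 2 * along (im_mx F) g X.
Proof.
move=> sH qH FH.
have dH i : partial i (im_form q) X = 2 * bil H (delta_mx i 0) X.
  have -> : im_form q = (fun X => bil H X X) by apply/funext.
  have [_ E] := is_derive_quad H X (delta_mx i 0).
  by rewrite /partial E sH bil_mxD; ring.
rewrite /hamilton_field /along big_split_ord /= -big_split /= mulr_sumr.
apply: eq_bigr => i _; rewrite !dH !(im_hamilton sH qH FH).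
have -> : \sum_(j < n) ((delta_mx (rshift n i) 0 : 'cV[R]_(n + n)) (rshift n j) 0 *
     (im_mx F *m X) (lshift n j) 0 -
    (delta_mx (rshift n i) 0 : 'cV[R]_(n + n)) (lshift n j) 0 *
     (im_mx F *m X) (rshift n j) 0) = (im_mx F *m X) (lshift n i) 0.
  rewrite (bigD1 i) //= big1 => [|j ji].
    by rewrite [X in X * _ - _]mxE [X in _ - X * _]mxE !eqxx eq_lrshift /=; ring.
  rewrite [X in X * _ - _]mxE [X in _ - X * _]mxE eq_lrshift eq_rshift.
  by rewrite (negbTE ji) /=; ring.
have -> : \sum_(j < n) ((delta_mx (lshift n i) 0 : 'cV[R]_(n + n)) (rshift n j) 0 *
     (im_mx F *m X) (lshift n j) 0 -
    (delta_mx (lshift n i) 0 : 'cV[R]_(n + n)) (lshift n j) 0 *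
     (im_mx F *m X) (rshift n j) 0) = - (im_mx F *m X) (rshift n i) 0.
  rewrite (bigD1 i) //= big1 => [|j ji].
    by rewrite [X in X * _ - _]mxE [X in _ - X * _]mxE !eqxx eq_rlshift /=; ring.
  rewrite [X in X * _ - _]mxE [X in _ - X * _]mxE eq_rlshift eq_lshift.
  by rewrite (negbTE ji) /=; ring.
by ring.
Qed.

End HamiltonMaps.

Section SymbolClass.
Context {R : realType} {d : nat}.

Lemma japanese_pow (X : 'cV[R]_d) (r : R) :
  japanese X `^ r = bracket2 X `^ (r / 2).
Proof.
by rewrite /japanese -powR12_sqrt ?bracket2_ge0 // -powRrM mulrC.
Qed.

Lemma symb_symbol_class (s : R) (Om : set 'cV[R]_d) (g : 'cV[R]_d -> R) :
  symb (decay s) (fun=> 1) g -> symbol_class Om japanese 0 s g.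
Proof.
move=> sg; split=> [w X _|alpha].
  have [sw dw] := symb_partials (decay_ge0 s) w sg; split=> [|i]; last exact: dw.
  exact: symb_upto_continuous (sw 0%N) X.
have [sw _] := symb_partials (decay_ge0 s)
  (flatten [seq nseq (alpha i) i | i <- enum 'I_d]) sg.
have [C C0 HC] := symb_upto_bound (sw 0%N).
exists (C + 1); first by rewrite ltr_wpDl.
move=> X _; apply: le_trans (HC X) _.
have -> : size (flatten [seq nseq (alpha i) i | i <- enum 'I_d]) = mlength alpha.
  rewrite size_flatten /shape -map_comp sumnE big_map /mlength big_enum /=.
  by apply: eq_bigr => i _; rewrite size_nseq.
rewrite mul1r japanese_pow -powR_mulrn ?decay_ge0 // /decay -powRrM.
have -> : - (s / 2) * (mlength alpha)%:R = (0 - s * (mlength alpha)%:R) / 2 by ring.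
by rewrite ler_wpM2r ?(ltW (bracket2_pow_gt0 _ _)) // lerDl.
Qed.

End SymbolClass.

Theorem proposition2p0p1 (R : realType) (n N m : nat)
    (n_ge1 : (1 <= n)%N) (N_ge1 : (1 <= N)%N) (m_ge1 : (1 <= m)%N)
    (q : 'I_N -> 'cV[R]_(n + n) -> R[i])
    (q_quad : forall j, quadratic_form (q j))
    (q_ge0 : forall j X, 0 <= re_form (q j) X)
    (F : 'I_N -> 'M[R[i]]_(n + n))
    (F_ham : forall j, is_hamilton_map (q j) (F j))
    (Omega0 : set 'cV[R]_(n + n)) (Omega0_open : open Omega0)
    (hyp : exists2 c0 : R, 0 < c0 & forall X, Omega0 X ->
       c0 * sqnorm X <=
       \sum_(k < m.+1) \sum_(j < N) \sum_(l : k.-tuple 'I_N)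
         re_form (q j) ((\big[mulmx/1%:M]_(a <- l) im_mx (F a)) *m X)) :
  exists (g : 'I_N -> 'cV[R]_(n + n) -> R) (c : R) (cj : 'I_N -> R),
    [/\ forall j, symbol_class Omega0 japanese 0 ((2 * m + 1)%:R^-1) (g j),
        0 < c,
        forall j, 0 < cj j &
        forall X, Omega0 X ->
          c * japanese X `^ (2%:R / (2 * m + 1)%:R) <=
          1 + \sum_(j < N)
                (re_form (q j) X
                 + cj j * hamilton_field (im_form (q j)) (g j) X)].
Proof.
have [c0 c00 hyp0] := hyp.
have /boolp.choice [M HM] := fun j => quadratic_form_bil (q_quad j).
pose G := \sum_j (M j).1.
have GE X : bil G X X = \sum_j re_form (q j) X.
  rewrite bil_mx_sum; apply: eq_bigr => j _.
  by have [_ _ -> _] := HM j.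
have Gsym : G^T = G.
  by rewrite /G linear_sum /=; apply: eq_bigr => j _; have [-> _ _ _] := HM j.
have Gpsd X : 0 <= bil G X X by rewrite GE sumr_ge0.
have hypG X : Omega0 X -> c0 * sqnorm X <=
    \sum_(k < m.+1) bil (gram (fun l => im_mx (F l)) G k) X X.
  move=> OX; apply: le_trans (hyp0 X OX) _; rewrite le_eqVlt; apply/orP; left.
  apply/eqP/eq_bigr => k _; rewrite bil_gram_words exchange_big /=.
  by apply: eq_bigr => w _; rewrite GE.
have [g [c [kap [sg c_gt0 kap_gt0 Hg]]]] :=
  subelliptic_multipliers N_ge1 Gsym Gpsd c00 hypG.
exists g, c, (fun=> kap / 2); split=> //.
- by move=> j; exact: symb_symbol_class.
- by move=> j; rewrite divr_gt0.
move=> X OX; rewrite japanese_pow.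
have -> : 2%:R / (2 * m + 1)%:R / 2 = rate m :> R by rewrite /rate mulrAC divff ?mul1r.
apply: le_trans (Hg X OX) _; rewrite le_eqVlt; apply/orP; left; apply/eqP.
rewrite GE -addrA mulr_sumr -big_split /=; congr (_ + _); apply: eq_bigr => j _.
have [_ sH _ qH] := HM j.
by rewrite (hamilton_field_along _ _ sH qH (F_ham j)); congr (_ + _); field.
Qed.
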